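(* For any integer $g \geq 3$, there is a layered graph $H(g)$ of girth at least $g$ such that the following holds: for any positive integer $n$ there is a colouring of the edges of the hypercube $Q_n$ in two colours such that there is no monochromatic copy of $H(g)$ (i.e. no subgraph of $Q_n$ isomorphic to $H(g)$ has all its edges of the same colour). In particular, $\pi_{\square}(H(g)) \geq 1/2$.
   Context: All graphs are finite and simple. The hypercube $Q_n$ (with ground set $[n]=\{1,\dots,n\}$) is the graph whose vertices are all subsets of $[n]$ and whose edges are all pairs $\{A,B\}$ with $A\subseteq B$ and $|A|=|B|-1$. The $i$th vertex layer of $Q_n$ is the set of vertices (subsets) of size $i$. The $i$th edge layer of $Q_n$ is the subgraph of $Q_n$ induced by the union of the $i$th and $(i-1)$st vertex layers. A graph is layered if it is (isomorphic to) a subgraph of some edge layer of a hypercube $Q_m$ for some $m$. For a graph $H$, $\mathrm{ex}(Q_n,H)$ is the largest number of edges in a subgraph of $Q_n$ that contains no subgraph isomorphic to $H$, and the Turán density of $H$ in a hypercube is $\pi_\square(H)=\lim_{n\to\infty}\mathrm{ex}(Q_n,H)/|E(Q_n)|$; the limit exists since this sequence is non-increasing in $n$. The graph $H(g)$ depends only on $g$, not on $n$. *)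

(* Defs.v *)
From mathcomp Require Import all_boot all_order all_algebra.
From mathcomp Require Import boolp reals topology normedtype sequences.

Set Implicit Arguments.
Unset Strict Implicit.
Unset Printing Implicit Defensive.

Import Order.TTheory GRing.Theory Num.Theory.
Import numFieldNormedType.Exports.

Record sgraph := SGraph {
  vertex :> finType;
  adj : rel vertex;
  adj_sym : symmetric adj;
  adj_irrefl : irreflexive adj }.

Definition edges (G : sgraph) : {set {set G}} :=
  [set [set p.1; p.2] | p : G * G & adj p.1 p.2].

(* The image of an embedding, with the images of the edges of H, is a (not
   necessarily induced) subgraph of G isomorphic to H, and every subgraph of G
   isomorphic to H arises in this way. *)
Definition embedding (H G : sgraph) (f : {ffun H -> G}) : bool :=
  injectiveb f && [forall x, forall y, adj x y ==> adj (f x) (f y)].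

Definition contains_copy (G H : sgraph) : bool :=
  [exists f : {ffun H -> G}, embedding f].

Section Subgraph.
Variables (G : sgraph) (W : {set G}) (F : {set {set G}}).

Definition sub_adj : rel {x : G | x \in W} :=
  fun x y => adj (val x) (val y) && ([set val x; val y] \in F).

Lemma sub_adj_sym : symmetric sub_adj.
Proof. by move=> x y; rewrite /sub_adj adj_sym setUC. Qed.

Lemma sub_adj_irrefl : irreflexive sub_adj.
Proof. by move=> x; rewrite /sub_adj adj_irrefl. Qed.

(* F may contain sets that are not edges of G inside W; they are ignored, so
   that the graphs [subgraph W F] are exactly all the subgraphs of G. *)
Definition subgraph : sgraph := SGraph sub_adj_sym sub_adj_irrefl.

End Subgraph.

Definition induced (G : sgraph) (W : {set G}) : sgraph :=
  subgraph W (edges G).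

Definition cycle_length (G : sgraph) (k : nat) : bool :=
  (2 < k) && [exists c : k.-tuple G, ucycleb (@adj G) c].

(* [None] stands for the infinite girth of an acyclic graph. *)
Definition girth (G : sgraph) : option nat :=
  if pselect (exists k, cycle_length G k) is left ex
  then Some (ex_minn ex) else None.

Definition girth_at_least (g : nat) (G : sgraph) : bool :=
  if girth G is Some k then g <= k else true.

Section Hypercube.
Variable n : nat.

Definition cube_adj : rel {set 'I_n} := fun A B =>
  (A \subset B) && (#|B| == #|A|.+1) || (B \subset A) && (#|A| == #|B|.+1).

Lemma cube_adj_sym : symmetric cube_adj.
Proof. by move=> A B; rewrite /cube_adj orbC. Qed.

Lemma cube_adj_irrefl : irreflexive cube_adj.
Proof. by move=> A; rewrite /cube_adj orbb ltn_eqF ?andbF. Qed.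

Definition hypercube : sgraph := SGraph cube_adj_sym cube_adj_irrefl.

Definition edge_layer (i : nat) : sgraph :=
  induced [set A : hypercube | (#|A| == i) || (#|A|.+1 == i)].

End Hypercube.

Definition layered (H : sgraph) : Prop :=
  exists m i : nat, contains_copy (edge_layer m i) H.

(* Only the values of a colouring at the edges of G matter. *)
Definition monochromatic_copy (G H : sgraph) (c : {set G} -> bool)
    (f : {ffun H -> G}) : Prop :=
  embedding f /\
  exists k : bool, forall x y : H, adj x y -> c [set f x; f y] = k.

Definition ex_cube (n : nat) (H : sgraph) : nat :=
  \max_(K : {set hypercube n} * {set {set hypercube n}}
         | ~~ contains_copy (subgraph K.1 K.2) H)
     #|edges (subgraph K.1 K.2)|.

Definition turan_density (R : realType) (H : sgraph) : R :=
  limn (fun n => (ex_cube n H)%:R / #|edges (hypercube n)|%:R : R)%R.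

(* Main.v *)
Require Import Defs.
From mathcomp Require Import all_boot all_order all_algebra.
From mathcomp Require Import zify.
From mathcomp Require Import boolp reals topology normedtype sequences.
(** Colour the edge {A, A + x} of the cube by the parity of the number of
    elements of A below x.  A hexagon inside an edge layer uses its directions
    in the order x y z x y z; the middle one of the three is crossed twice, with
    exactly one smaller direction crossed in between, so the hexagon is not
    monochromatic.  Every other hexagon has a chord, and a short argument about
    these chords shows that no monochromatic subdivided K_5 exists in which all
    the branch vertices are distinct and so are the neighbours of each of them.

    For the pairs and triples of a 6-partite ground set, each transversal
    ux_1...x_5 gives such a K_5 with branch vertices ux_i and subdividing vertices
    ux_ix_j.  A triple contains three pairs, so its image is determined by the
    images of the pairs.  Hence, for any assignment of cube vertices to pairs,
    some two triples ux_ix_j and ux_ix_l cannot be placed: a positive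
    proportion of all configurations "(u; x, y, z): triples uxy and uxz" fail.
    Up to relabelling of directions there are only exp(O(m^2 log m)) relevant
    assignments, since they are encoded along a spanning forest of the O(m^2)
    pairs.  So a greedy choice of O(m^2 log m) configurations, each killing a
    positive proportion of the surviving assignments, kills them all.  Most
    pairs are used O(log m) times only, so that balls of bounded radius have
    polylogarithmic size and almost every configuration can be added without
    closing a short cycle. *)

Set Implicit Arguments.
Unset Strict Implicit.
Unset Printing Implicit Defensive.

Import Order.TTheory GRing.Theory Num.Theory numFieldNormedType.Exports.

(** * Monochromatic configurations in the cube *)

Lemma odd_count (T : finType) (a : pred T) (s : seq T) :
  odd (count a s) = \big[addb/false]_(t | a t) odd (count_mem t s).
Proof.
elim: s => [|x s IH] /=; first by rewrite big1.
rewrite oddD IH; under [RHS]eq_bigr do rewrite oddD.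
rewrite big_split /=; congr (_ (+) _).
have [ax|nax] := boolP (a x).
  rewrite (bigD1 x) //= eqxx big1 ?addbF // => t /andP[_ /negbTE].
  by rewrite eq_sym => ->.
by rewrite big1 // => t at_; case: eqP => // e; rewrite e at_ in nax.
Qed.

(** Vertices are encoded only up to parities of multiplicities, while colours count labels below a
    bound; this carries such counts from one encoding of a vertex to another. *)
Lemma eq_odd_count (T : finType) (s s' : seq T) :
  (forall t, odd (count_mem t s) = odd (count_mem t s')) ->
  forall a : pred T, odd (count a s) = odd (count a s').
Proof. by move=> e a; rewrite !odd_count; apply: eq_bigr. Qed.

(** The positions of a label form an independent set of the six-cycle of even size, hence of size
    two. So equal labels match the six positions and never match neighbours; the complement of the
    six-cycle, a triangular prism, has just these four perfect matchings. *)
Lemma hexagon_labels (T : eqType) (p1 p2 p3 p4 p5 p6 : T) :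
  p1 != p2 -> p2 != p3 -> p3 != p4 -> p4 != p5 -> p5 != p6 -> p6 != p1 ->
  (forall t, (p1 == t) (+) (p2 == t) (+) (p3 == t)
    (+) (p4 == t) (+) (p5 == t) (+) (p6 == t) = false) ->
  [|| (p1 == p3) && (p4 == p6), (p2 == p4) && (p5 == p1),
      (p3 == p5) && (p6 == p2) |
      [&& p1 == p4, p2 == p5 & p3 == p6]].
Proof.
have tr (x y z : T) : y != z -> ~~ ((x == y) && (x == z)).
  by apply: contra => /andP[/eqP <- /eqP <-].
move=> n12 n23 n34 n45 n56 n61 E.
move: (tr p1 _ _ n34) (tr p1 _ _ n45) (tr p2 _ _ n45) (tr p2 _ _ n56)
  (tr p3 _ _ n56) (tr p3 _ _ n61) (tr p4 _ _ n61) (tr p4 _ _ n12)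
  (tr p5 _ _ n12) (tr p5 _ _ n23) (tr p6 _ _ n23) (tr p6 _ _ n34).
move: (E p1) (E p2) (E p3) (E p4) (E p5) (E p6).
rewrite !eqxx !(eq_sym p2 p1) !(eq_sym p3 p1) !(eq_sym p3 p2) !(eq_sym p4 p1)
  !(eq_sym p4 p2) !(eq_sym p4 p3) !(eq_sym p5 p1) !(eq_sym p5 p2)
  !(eq_sym p5 p3) !(eq_sym p5 p4) !(eq_sym p6 p1) !(eq_sym p6 p2)
  !(eq_sym p6 p3) !(eq_sym p6 p4) !(eq_sym p6 p5).
rewrite (eq_sym p6 p1) in n61.
rewrite !(negbTE n12) !(negbTE n23) !(negbTE n34) !(negbTE n45) !(negbTE n56)
  !(negbTE n61).
by case: (p1 == p3); case: (p1 == p4); case: (p1 == p5);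
   case: (p2 == p4); case: (p2 == p5); case: (p2 == p6);
   case: (p3 == p5); case: (p3 == p6); case: (p4 == p6).
Qed.

(* A vertex of the cube is encoded by a list of directions (the steps of a walk
   from some base point, so that only parities of multiplicities matter) and
   [q] records the contribution of the base point to the colour. *)
Definition colour n (q : 'I_n -> bool) (s : seq 'I_n) (x : 'I_n) : bool :=
  q x (+) odd (count (fun t : 'I_n => t < x) s).

Section Core.
Variables (n : nat) (q : 'I_n -> bool) (k : bool).
(** [A i] is the branch vertex i of a subdivided K_5, and [p i j] the direction from it to the
    vertex subdividing the edge ij. *)
Variables (A : 'I_5 -> seq 'I_n) (p : 'I_5 -> 'I_5 -> 'I_n).
Hypothesis adjP : forall i j, i != j -> forall t,
  odd (count_mem t (p i j :: A i)) = odd (count_mem t (p j i :: A j)).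
Hypothesis p_sym : forall i j, i != j -> p i j != p j i.
Hypothesis p_inj : forall i j l, i != j -> i != l -> j != l -> p i j != p i l.
Hypothesis p_col : forall i j, i != j -> colour q (A i) (p i j) = k.

Let a i t := odd (count_mem t (A i)).

Let aE i j t : i != j -> a j t = a i t (+) (p i j == t) (+) (p j i == t).
Proof.
move=> nij; have := adjP nij t; rewrite /= !oddD !oddb -/(a i t) -/(a j t).
by case: (a i t); case: (a j t); case: (_ == _); case: (_ == _).
Qed.

(** Each of the three outcomes is a chord of the hexagon: the vertex subdividing one of the pairs is
    adjacent to the third branch vertex as well. *)
Lemma mono_hexagon i j l : i != j -> i != l -> j != l ->
  [|| (p i j == p j l) && (p i l == p l j),
      (p j i == p i l) && (p j l == p l i) |
      (p l i == p i j) && (p l j == p j i)].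
Proof.
move=> nij nil njl.
have [nji nli nlj] : [/\ j != i, l != i & l != j] by rewrite !(eq_sym _ i) (eq_sym l).
have := @hexagon_labels _ (p i j) (p j i) (p j l) (p l j) (p l i) (p i l)
  (p_sym nij) (p_inj nji njl nil) (p_sym njl) (p_inj nlj nli nji) (p_sym nli)
  (p_inj nil nij nlj).
case/(_ _)/or4P.
- move=> t; have := aE t nil; rewrite (aE t njl) (aE t nij).
  by case: (a i t); do 6! case: (_ == t).
- by move=> /andP[/eqP -> /eqP ->]; rewrite !eqxx.
- by move=> /andP[/eqP -> /eqP ->]; rewrite !eqxx !orbT.
- by move=> /andP[/eqP -> /eqP ->]; rewrite !eqxx !orbT.
(* The labels now read x y z x y z. Each of these directions has colour [k] at two branch vertices,
   and the path of length two between them crosses the other two directions, which therefore lie on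
   the same side of it. So no direction is the middle one. *)
case/and3P => /eqP e1 /eqP e2 /eqP e3; exfalso.
have par b c x : b != c -> odd (count (fun t : 'I_n => t < x) (A c)) =
   odd (count (fun t : 'I_n => t < x) (A b)) (+) (p b c < x) (+) (p c b < x).
  move=> nbc; have /= := eq_odd_count (adjP nbc) (fun t : 'I_n => t < x).
  rewrite !oddD !oddb; case: (odd _); case: (odd _); case: (_ < _); by case: (_ < _).
have sep b c x : b != c -> colour q (A b) x = k -> colour q (A c) x = k ->
    (p b c < x) = (p c b < x).
  move=> nbc <-; rewrite /colour (par b c x nbc).
  by case: (q x); case: (odd _); case: (_ < _); case: (_ < _).
have cx := sep i l (p i j) nil (p_col nij).
rewrite {1}e1 p_col // -e2 -e3 in cx; move: (cx erefl) => {}cx.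
have cy := sep j l (p j i) njl (p_col nji).
rewrite {1}e2 p_col // -e1 in cy; move: (cy erefl) => {}cy.
have cz := sep i j (p j l) nij.
rewrite {1}e3 !p_col // in cz; move: (cz erefl erefl) => {}cz.
move: (p_inj nil nij nlj) (p_sym nij) (p_inj nji njl nil) cx cy cz.
rewrite -e3 -!val_eqE /=; lia.
Qed.

(* [c i] is the direction from the candidate centre, given as a function of the
   coordinates, to [A i]. *)
Lemma no_monochromatic_K5_in_star (C : 'I_n -> bool) (c : 'I_5 -> 'I_n) :
  (forall i t, a i t = C t (+) (c i == t)) -> False.
Proof.
move=> aC.
have c_inj i j : i != j -> c i != c j.
  move=> nij; apply/eqP => e; have := aE (p i j) nij.
  rewrite !aC e eqxx (eq_sym (p j i)) (negbTE (p_sym nij)).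
  by case: (C _); case: (_ == _).
(* The difference of [A i] and [A j] is {c i, c j}, that of [A i] and [A l] is {c i, c l}; a label
   common to both is [c i], so the subdividing vertex is the centre. *)
have pc i j l : i != j -> i != l -> j != l -> p l i = p i j -> p i j = c i.
  move=> nij nil njl e; have nli : l != i by rewrite eq_sym.
  have := aE (p i j) nij; have := aE (p i j) nil.
  have s1 : (p i l == p i j) = false by rewrite -e eq_sym (negbTE (p_sym nli)).
  have s3 : (p j i == p i j) = false by rewrite eq_sym (negbTE (p_sym nij)).
  rewrite !aC e eqxx s1 s3.
  case: (eqVneq (c i) (p i j)) => [-> //|_].
  case: (eqVneq (c l) (p i j)) => [<-|_]; last by case: (C _).
  by rewrite (negbTE (c_inj _ _ njl)); case: (C _).
have M i j l : i != j -> i != l -> j != l ->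
    [|| (p i j == c i) && (p j i == c j), (p i l == c i) && (p l i == c l) |
        (p j l == c j) && (p l j == c l)].
  move=> nij nil njl.
  have [nji nli nlj] : [/\ j != i, l != i & l != j]
    by rewrite !(eq_sym _ i) (eq_sym l).
  case/or3P: (mono_hexagon nij nil njl) => /andP[/eqP e1 /eqP e2].
  - by rewrite (pc j l i) // (pc l j i) // !eqxx !orbT.
  - by rewrite (pc i l j) // (pc l i j) // !eqxx !orbT.
  - by rewrite (pc i j l) // (pc j i l) // !eqxx.
have X i j l : i != j -> i != l -> j != l -> p i j = c i -> (p i l == c i) = false.
  by move=> nij nil njl <-; rewrite eq_sym (negbTE (p_inj nij nil njl)).
(* The pairs subdivided by the centre form a matching, by [X], that contains a pair of every triple,
   by [M]; this is impossible on five points. *)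
have N i j l a1 a2 : uniq [:: i; j; l; a1; a2] -> p i j = c i -> False.
  rewrite /= !inE !negb_or => /and5P[/and4P[nij nil nia nib] /and3P[njl nja njb]
    /andP[nla nlb] nab _] e.
  have := M i l a1; rewrite (X i j l) // (X i j a1) //= => /(_ nil nia nla).
  case/andP=> /eqP e1 _.
  have := M i l a2; rewrite (X i j l) // (X i j a2) //= => /(_ nil nib nlb).
  by rewrite (X l a1 a2).
pose o m (h : m < 5) := Ordinal h.
have := M (@o 0 isT) (@o 1 isT) (@o 2 isT) isT isT isT.
case/or3P => /andP[/eqP e _].
- exact: (N _ _ (@o 2 isT) (@o 3 isT) (@o 4 isT) _ e).
- exact: (N _ _ (@o 1 isT) (@o 3 isT) (@o 4 isT) _ e).
- exact: (N _ _ (@o 0 isT) (@o 3 isT) (@o 4 isT) _ e).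
Qed.

(** [Y] is a vertex relative to the centre of a star, at distance two from three leaves. It has one
    element or three, and in the latter case it must contain [c1], [c2] and [c3]. *)
Lemma distance_two_from_star (Y : 'I_n -> bool) (c1 c2 c3 u1 u2 v1 v2 w1 w2 : 'I_n) :
  c1 != c2 -> c1 != c3 -> c2 != c3 -> u1 != u2 -> v1 != v2 -> w1 != w2 ->
  (forall t, Y t = (c1 == t) (+) (u1 == t) (+) (u2 == t)) ->
  (forall t, Y t = (c2 == t) (+) (v1 == t) (+) (v2 == t)) ->
  (forall t, Y t = (c3 == t) (+) (w1 == t) (+) (w2 == t)) ->
  (exists x, forall t, Y t = (x == t)) \/
  (forall t, Y t = (c1 == t) (+) (c2 == t) (+) (c3 == t)).
Proof.
move=> n12 n13 n23 nu nv nw E1 E2 E3.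
have S (c u v : 'I_n) : (forall t, Y t = (c == t) (+) (u == t) (+) (v == t)) ->
    (exists x, forall t, Y t = (x == t)) \/ (u != c /\ v != c).
  move=> E; have [e|ne] := eqVneq u c.
    by left; exists v => t; rewrite E e; do 2! case: (_ == t).
  have [e|ne'] := eqVneq v c; last by right.
  by left; exists u => t; rewrite E e; do 2! case: (_ == t).
have [|[u1c u2c]] := S _ _ _ E1; first by left.
have [|[v1c v2c]] := S _ _ _ E2; first by left.
have [|[w1c w2c]] := S _ _ _ E3; first by left.
right; have := E1 c2; rewrite E2 eqxx (negbTE v1c) (negbTE v2c) (negbTE n12) /=.
have := E1 c3; rewrite E3 eqxx (negbTE w1c) (negbTE w2c) (negbTE n13) /=.
move=> e3 e2 t; rewrite E1 -!addbA; congr (_ (+) _).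
have [e|/negbTE nu1] := eqVneq u1 c2; first subst u1.
  move: e3; rewrite (negbTE n23) /=; by case: eqP => // ->.
move: e2; rewrite nu1 /=; case: eqP => // e _; subst u2.
by move: e3; rewrite (negbTE n23) addbF; case: eqP => // -> _; rewrite addbC.
Qed.

Lemma no_monochromatic_K5 : False.
Proof.
(* The chord makes the vertex [C] subdividing ij a common neighbour of the branch vertices i, j, l.
   Each of the other two is at distance two from these three, so it is a neighbour of [C] or the
   antipode of [C] in the 3-cube they span. *)
have main i j l x y : uniq [:: i; j; l; x; y] ->
    (p l i == p i j) && (p l j == p j i) -> False.
  rewrite /= !inE !negb_or => /and5P[/and4P[nij nil nix niy] /and3P[njl njx njy]
    /andP[nlx nly] nxy _] /andP[/eqP e1 /eqP e2].
  have [nji nli nlj] : [/\ j != i, l != i & l != j]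
    by rewrite !(eq_sym _ i) (eq_sym l).
  pose C t := a i t (+) (p i j == t).
  have Ci t : a i t = C t (+) (p i j == t) by rewrite /C addbK.
  have Cj t : a j t = C t (+) (p j i == t) by rewrite /C (aE t nij).
  have Cl t : a l t = C t (+) (p i l == t).
    by rewrite /C (aE t nil) e1; case: (a i t); do 2! case: (_ == t).
  have nd1 : p i j != p i l by apply: p_inj.
  have nd2 : p j i != p i l.
    apply/eqP => e; have := aE (p i l) njl.
    rewrite Cj Cl -e eqxx e2 eqxx; have := p_sym njl; rewrite e2 => /negbTE ->.
    by case: (C _).
  have nd0 : p i j != p j i by apply: p_sym.
  have far z : i != z -> j != z -> l != z ->
    (exists w, forall t, a z t (+) C t = (w == t)) \/
    (forall t, a z t (+) C t = (p i j == t) (+) (p j i == t) (+) (p i l == t)).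
    move=> niz njz nlz.
    apply: (distance_two_from_star nd0 nd1 nd2 (p_sym niz) (p_sym njz) (p_sym nlz)) => t.
    - by rewrite (aE t niz) Ci; case: (C t); do 3! case: (_ == t).
    - by rewrite (aE t njz) Cj; case: (C t); do 3! case: (_ == t).
    - by rewrite (aE t nlz) Cl; case: (C t); do 3! case: (_ == t).
  have dist z z' t : z != z' -> (a z t (+) C t) (+) (a z' t (+) C t) =
      (p z z' == t) (+) (p z' z == t).
    by move=> nz; rewrite (aE t nz); case: (C t); case: (a z t); do 2! case: (_ == t).
  (* A neighbour of [C] is at distance two from the antipode only if its direction is one of the
     three, but then it coincides with a branch vertex i, j or l. *)
  have mixed z z' w : z != z' -> i != z' -> j != z' -> l != z' ->
      (forall t, a z' t (+) C t = (w == t)) ->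
      (forall t, a z t (+) C t = (p i j == t) (+) (p j i == t) (+) (p i l == t)) ->
      False.
    move=> nz niz njz nlz Hw H3.
    have D t : (p i j == t) (+) (p j i == t) (+) (p i l == t) (+) (w == t) =
      (p z z' == t) (+) (p z' z == t) by rewrite -Hw -H3 dist.
    have ne r d : r != z' -> (forall t, a r t = C t (+) (d == t)) -> d != w.
      move=> nr Hr; apply/eqP => e; have := aE (p r z') nr.
      rewrite eqxx (eq_sym (p z' r)) (negbTE (p_sym nr)) Hr.
      have := Hw (p r z'); rewrite e.
      by case: (a _ _); case: (C _); case: (_ == _).
    have F (u v : 'I_n) : u != v -> (u == v) = false /\ (v == u) = false.
      by move=> nuv; rewrite (eq_sym v) (negbTE nuv).
    have [[f0 f0'] [f1 f1'] [f2 f2']] := And3 (F _ _ nd0) (F _ _ nd1) (F _ _ nd2).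
    have [_ fi] := F _ _ (ne i _ niz Ci); have [_ fj] := F _ _ (ne j _ njz Cj).
    have [_ fl] := F _ _ (ne l _ nlz Cl).
    have := D (p i j); have := D (p j i); have := D (p i l).
    rewrite !eqxx f0 f0' f1 f1' f2 f2' fi fj fl /= => h1 h2 h3.
    have [e|z1] := eqVneq (p z z') (p i l).
      move: h2 h3; rewrite e f1' f2' /= => /esym/eqP ->; by rewrite f0'.
    move: h1; rewrite (negbTE z1) /= => /esym/eqP e.
    by move: h2 h3; rewrite e f1' f2' !addbF => /esym/eqP ->; rewrite f0'.
  have nyx : y != x by rewrite eq_sym.
  (* Two neighbours of [C] give a star; two antipodes are the same vertex. *)
  have [[wx Hx]|Hx] := far x nix njx nlx; have [[wy Hy]|Hy] := far y niy njy nly.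
  - pose c z := if z == i then p i j else if z == j then p j i else
      if z == l then p i l else if z == x then wx else wy.
    apply: (@no_monochromatic_K5_in_star C c) => z t; rewrite /c.
    have [->|zi] := eqVneq z i; first exact: Ci.
    have [->|zj] := eqVneq z j; first exact: Cj.
    have [->|zl] := eqVneq z l; first exact: Cl.
    have [->|zx] := eqVneq z x; first by rewrite -Hx; case: (a x t); case: (C t).
    suff -> : z = y by rewrite -Hy; case: (a y t); case: (C t).
    apply/eqP; apply: contraT => zy.
    have U : uniq [:: i; j; l; x; y; z].
      rewrite /= !inE !negb_or nij nil nix niy njl njx njy nlx nly nxy /=.
      by rewrite !(eq_sym _ z) zi zj zl zx zy.
    by have := max_card (mem [:: i; j; l; x; y; z]); rewrite (card_uniqP U) card_ord.
  - exact: (mixed y x wx nyx nix njx nlx Hx Hy).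
  - exact: (mixed x y wy nxy niy njy nly Hy Hx).
  - have := dist x y (p x y) nxy; rewrite Hx Hy addbb eqxx eq_sym.
    by rewrite (negbTE (p_sym nxy)).
pose o m (h : m < 5) := Ordinal h.
have := @mono_hexagon (@o 0 isT) (@o 1 isT) (@o 2 isT) isT isT isT.
case/or3P.
- exact: (main (@o 1 isT) (@o 2 isT) (@o 0 isT) (@o 3 isT) (@o 4 isT)).
- exact: (main (@o 0 isT) (@o 2 isT) (@o 1 isT) (@o 3 isT) (@o 4 isT)).
- exact: (main (@o 0 isT) (@o 1 isT) (@o 2 isT) (@o 3 isT) (@o 4 isT)).
Qed.

End Core.

(** * Stars: a triple as a common neighbour of its three pairs *)

Section Star.
Variables (n : nat) (q : 'I_n -> bool) (k : bool).
Implicit Types (A B M : seq 'I_n) (P : 'I_n * 'I_n * 'I_n).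

(** [A], [B], [M] are the images of the pairs in a triple, and [P] lists the directions from them to
    the image of the triple. *)
Definition star A B M P : bool :=
  [&& uniq [:: P.1.1; P.1.2; P.2],
      [forall t, odd (count_mem t (P.1.1 :: A)) == odd (count_mem t (P.1.2 :: B))],
      [forall t, odd (count_mem t (P.1.1 :: A)) == odd (count_mem t (P.2 :: M))],
      colour q A P.1.1 == k & colour q B P.1.2 == k].

Definition double_star A B M B' M' : bool :=
  [exists P, exists P', [&& star A B M P, star A B' M' P' & P.1.1 != P'.1.1]].

Lemma star_sym A B M P : star A B M P -> star B A M (P.1.2, P.1.1, P.2).
Proof.
case/and5P; rewrite /= !inE negb_or andbT => /andP[/andP[n1 n2] n3].
move=> /forallP E1 /forallP E2 c1 c2.
apply/and5P; split=> //=; first by rewrite !inE negb_or eq_sym n1 n3 n2.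
  by apply/forallP => t; rewrite eq_sym; apply: E1.
by apply/forallP => t; rewrite -(eqP (E1 t)); apply: E2.
Qed.

(* Three vertices of the cube have at most one common neighbour. *)
Lemma star_inj A B M P P' : star A B M P -> star A B M P' -> P = P'.
Proof.
case: P => [[p1 p2] p3]; case: P' => [[r1 r2] r3].
case/and5P => /= + /forallP E1 /forallP E2 _ _.
rewrite !inE negb_or andbT => /andP[/andP[n12 n13] n23].
case/and5P => /= + /forallP F1 /forallP F2 _ _.
rewrite !inE negb_or andbT => /andP[/andP[m12 m13] m23].
have G1 t : (p1 == t) (+) (p2 == t) = (r1 == t) (+) (r2 == t).
  have := E1 t; have := F1 t; rewrite !oddD !oddb.
  by case: (odd _); case: (odd _); do 4! case: (_ == t).
have G2 t : (p1 == t) (+) (p3 == t) = (r1 == t) (+) (r3 == t).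
  have := E2 t; have := F2 t; rewrite !oddD !oddb.
  by case: (odd _); case: (odd _); do 4! case: (_ == t).
have H2 (x y z w : 'I_n) : x != y -> z != w ->
    (forall t, (x == t) (+) (y == t) = (z == t) (+) (w == t)) ->
    (x = z /\ y = w) \/ (x = w /\ y = z).
  move=> /negbTE xy zw H; move: (H x) (H y).
  rewrite !eqxx (eq_sym y x) xy /=; have [->|_] := eqVneq z x.
    by rewrite xy /= => _ /esym/eqP ->; left.
  by move=> /esym/eqP ->; rewrite xy addbF => /esym/eqP ->; right.
have [[e1 e2]|[e1 e2]] := H2 _ _ _ _ n12 m12 G1;
  have [[e3 e4]|[e3 e4]] := H2 _ _ _ _ n13 m13 G2.
- by rewrite e1 e2 e4.
- by rewrite e1 e4 eqxx in n13.
- by rewrite -e1 e3 eqxx in m12.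
- by rewrite e2 e4 eqxx in n23.
Qed.

(** [A i] is the image of ux_i and [M i j] that of x_ix_j. Since stars are unique, those of all the
    double stars fit together into one subdivided K_5; the last clause of [double_star] keeps the
    neighbours of a branch vertex distinct. *)
Lemma double_star_contra (A : 'I_5 -> seq 'I_n) (M : 'I_5 -> 'I_5 -> seq 'I_n) :
  (forall i j, M i j = M j i) ->
  ~ (forall i j l, uniq [:: i; j; l] ->
       double_star (A i) (A j) (M i j) (A l) (M i l)).
Proof.
move=> Msym H.
pose o m (h : m < 5) := Ordinal h.
have /existsP[d _] := H (@o 0 isT) (@o 1 isT) (@o 2 isT) isT.
pose P i j := odflt d [pick P | star (A i) (A j) (M i j) P].
have third (i j : 'I_5) : exists l, (i != l) && (j != l).
  have : 0 < #|~: [set i; j]|.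
    by have := cardsC [set i; j]; rewrite card_ord cards2; case: (_ == _); lia.
  case/card_gt0P => l; rewrite !inE negb_or => /andP[li lj].
  by exists l; rewrite !(eq_sym _ l) li lj.
have PP i j : i != j -> star (A i) (A j) (M i j) (P i j).
  move=> nij; rewrite /P; case: pickP => //= H0.
  have [l /andP[nil njl]] := third i j.
  have /existsP[R /existsP[R' /and3P[]]] : double_star (A i) (A j) (M i j) (A l) (M i l).
    by apply: H; rewrite /= !inE negb_or nij nil njl.
  by rewrite H0.
have Psym i j : i != j -> (P i j).1.2 = (P j i).1.1.
  move=> nij; have nji : j != i by rewrite eq_sym.
  have := star_sym (PP _ _ nij); rewrite Msym => S.
  by rewrite -(star_inj S (PP _ _ nji)).
apply: (@no_monochromatic_K5 n q k A (fun i j => (P i j).1.1)).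
- move=> i j nij t; rewrite -(Psym _ _ nij).
  by have /and5P[_ /forallP /(_ t) /eqP] := PP _ _ nij.
- move=> i j nij; rewrite -(Psym _ _ nij).
  by have /and5P[/=] := PP _ _ nij; rewrite !inE negb_or => /andP[/andP[]].
- move=> i j l nij nil njl.
  have /existsP[R /existsP[R' /and3P[S S']]] : double_star (A i) (A j) (M i j) (A l) (M i l).
    by apply: H; rewrite /= !inE negb_or nij nil njl.
  by rewrite (star_inj S (PP _ _ nij)) (star_inj S' (PP _ _ nil)).
- by move=> i j nij; have /and5P[_ _ _ /eqP] := PP _ _ nij.
Qed.
End Star.

(** * Greedy selection *)

Section Greedy.
Variables (W F : finType) (bad : F -> pred W) (ok : seq W -> pred W).

Fixpoint ok_chain (s : seq W) : bool :=
  if s is w :: s' then ok s' w && ok_chain s' else true.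

Definition alive (s : seq W) : {set F} := [set f | all (fun w => ~~ bad f w) s].

Variables (K t : nat).
Hypotheses (K_gt0 : 0 < K) (W_gt0 : 0 < #|W|).
Hypothesis many_bad : forall f, #|W| <= K * #|[set w | bad f w]|.
Hypothesis few_forbidden : forall s, ok_chain s -> size s <= t ->
  2 * K * #|[set w | ~~ ok s w]| <= #|W|.

(** At least |W|/K units are bad for [f] and at most |W|/(2K) are forbidden, so at least |W|/(2K)
    are both allowed and bad. Averaging over the allowed units gives one that kills a 1/(2K) share
    of the survivors. *)
Lemma greedy_step s : ok_chain s -> size s <= t ->
  exists2 w, ok s w & #|alive s| <= 2 * K * #|[set f in alive s | bad f w]|.
Proof.
move=> oks szs; apply/exists_inP; apply: contraT => /exists_inPn N.
pose kill w := #|[set f in alive s | bad f w]|.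
have L f : f \in alive s -> #|W| <= 2 * K * #|[set w | ok s w && bad f w]|.
  move=> _; have := many_bad f; have := few_forbidden oks szs.
  have : #|[set w | bad f w]| <=
      #|[set w | ok s w && bad f w]| + #|[set w | ~~ ok s w]|.
    rewrite -cardsUI; apply: leq_trans (leq_addr _ _).
    by apply/subset_leq_card/subsetP => w; rewrite !inE => ->; case: (ok s w).
  nia.
have dc : \sum_(w | ok s w) kill w =
    \sum_(f in alive s) #|[set w | ok s w && bad f w]|.
  rewrite (eq_bigr (fun w => \sum_(f in alive s) bad f w)) => [|w _]; last first.
    by rewrite /kill -sum1_card big_mkcond [RHS]big_mkcond; apply: eq_bigr => f _;
       rewrite !inE; case: (all _ _); case: (bad f w).
  rewrite exchange_big; apply: eq_bigr => f _.
  by rewrite -sum1_card big_mkcond [RHS]big_mkcond; apply: eq_bigr => w _;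
     rewrite !inE; case: (ok s w); case: (bad f w).
have h1 : #|alive s| * #|W| <= 2 * K * \sum_(w | ok s w) kill w.
  by rewrite dc big_distrr /= -sum_nat_const; apply: leq_sum.
(* The added number of allowed units records that each summand is strictly smaller; it is positive
   because at most half of the units are forbidden. *)
have h2 : 2 * K * (\sum_(w | ok s w) kill w) + #|[set w | ok s w]| <=
    #|alive s| * #|[set w | ok s w]|.
  have -> : #|[set w | ok s w]| = \sum_(w | ok s w) 1.
    by rewrite -sum1_card; apply: eq_bigl => w; rewrite inE.
  rewrite !big_distrr -big_split /=; apply: leq_sum => w okw.
  by have := N w okw; rewrite -ltnNge addn1 muln1.
have := cardsC [set w | ok s w].
rewrite (_ : ~: [set w | ok s w] = [set w | ~~ ok s w]); last by apply/setP => w; rewrite !inE.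
have := few_forbidden oks szs.
nia.
Qed.

(** Each step multiplies the number of survivors by at most 1 - 1/(2K). *)
Lemma greedy_chain : exists s, [/\ ok_chain s, size s = t &
  #|alive s| * (2 * K) ^ t <= #|F| * (2 * K).-1 ^ t].
Proof.
suff S t' : t' <= t -> exists s, [/\ ok_chain s, size s = t' &
    #|alive s| * (2 * K) ^ t' <= #|F| * (2 * K).-1 ^ t'] by apply: S.
elim: t' => [_|t' IH lt].
  by exists [::]; split; rewrite // !expn0 !muln1 max_card.
have [s [oks szs B]] := IH (ltnW lt).
have [|w okw kw] := greedy_step oks; first by rewrite szs ltnW.
exists (w :: s); split; rewrite /= ?okw ?szs //.
have : #|alive (w :: s)| + #|[set f in alive s | bad f w]| = #|alive s|.
  rewrite -cardsUI (_ : _ :&: _ = set0) ?cards0 ?addn0.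
    by apply: eq_card => f; rewrite !inE /=; case: (bad f w); case: (all _ _).
  apply/setP => f; rewrite !inE /= andbC -andbA andbCA; by case: (bad f w); rewrite ?andbF.
move: kw; set a := #|alive s| in B *; set a' := #|alive _|; set b := #|[set _ in _ | _]|.
move=> kw ab.
have {}ab : a' * (2 * K) <= a * (2 * K).-1 by rewrite -ab in kw *; nia.
rewrite !expnS; apply: (@leq_trans (a * (2 * K) ^ t' * (2 * K).-1)).
  by rewrite mulnA [X in _ <= X]mulnAC leq_mul2r ab orbT.
by rewrite [X in _ <= _ * X]mulnC mulnA leq_mul2r B orbT.
Qed.

Lemma greedy_kills : #|F| * (2 * K).-1 ^ t < (2 * K) ^ t ->
  exists s, [/\ ok_chain s, size s = t & forall f, has (bad f) s].
Proof.
move=> lt; have [s [oks szs B]] := greedy_chain; exists s; split=> // f.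
have a0 : #|alive s| = 0 by case: #|_| B => //; nia.
have := cards0_eq a0 => /setP/(_ f); rewrite !inE => /negbT.
by rewrite -has_predC; apply: sub_has => w; rewrite /= negbK.
Qed.
End Greedy.

(** * Short cycles in incidence graphs of triple systems *)

Section Balls.
Variables (V : finType) (e : rel V).

Fixpoint ball (k : nat) (x : V) : {set V} :=
  if k is k'.+1 then
    ball k' x :|: [set z | [exists y in ball k' x, e y z]]
  else [set x].

Lemma ball_refl k x : x \in ball k x.
Proof. by elim: k => [|k IH] /=; rewrite inE ?IH. Qed.

Lemma path_ball x p k : path e x p -> size p <= k -> last x p \in ball k x.
Proof.
elim/last_ind: p k => [|p y IH] k; first by rewrite ball_refl.
case: k => [|k]; rewrite size_rcons // ltnS rcons_path last_rcons.
move=> /andP[pp ey] sz; rewrite !inE.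
by apply/orP; right; apply/exists_inP; exists (last x p); rewrite ?IH.
Qed.

Lemma card_ball d k x :
  (forall y, #|[set z | e y z]| <= d) -> #|ball k x| <= d.+1 ^ k.
Proof.
move=> deg; elim: k => [|k IH] /=; first by rewrite cards1.
rewrite expnS mulSn (leq_trans (leq_card_setU _ _)) // leq_add //.
have sub : [set z | [exists y in ball k x, e y z]] \subset
    \bigcup_(y in ball k x) [set z | e y z].
  apply/subsetP => z; rewrite inE => /exists_inP[y yb yz].
  by apply/bigcupP; exists y; rewrite // inE.
apply: leq_trans (subset_leq_card sub) _.
apply: (@leq_trans (\sum_(y in ball k x) #|[set z | e y z]|)).
  elim/big_rec2: _ => [|y b U _ le]; first by rewrite cards0.
  by rewrite (leq_trans (leq_card_setU _ _)) // leq_add2l.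
apply: leq_trans (leq_sum _ (fun y _ => deg y)) _.
by rewrite sum_nat_const mulnC leq_mul2l IH orbT.
Qed.

(** Rotating the cycle to start at [x] and removing [x] leaves a path between two distinct
    neighbours of [x]. *)
Lemma cycle_at c x : cycle e c -> uniq c -> 2 < size c -> x \in c ->
  exists a p, [/\ path e a p, last a p != a, e x a /\ e (last a p) x,
    uniq [:: x, a & p] /\ size c = (size p).+2 & {subset a :: p <= c}].
Proof.
move=> cc uc sc xc; have [i c' E] := rot_to xc.
have : size (rot i c) = size c by rewrite size_rot.
move: cc uc; rewrite -(rot_cycle i) -(rot_uniq i) E.
case: c' E => [|a p] E /= cc uc sz; first by rewrite -sz in sc.
exists a, p; move: cc; rewrite rcons_path => /and3P[xa pp px]; split=> //.
- case: p {E pp px} uc sz => [_ sz|b p]; first by rewrite -sz in sc.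
  rewrite /= => /and3P[_ + _] _; apply: contraNneq => la; rewrite -{1}la; exact: mem_last.
- by move=> y yp; rewrite -(mem_rot i) E inE yp orbT.
Qed.

End Balls.

Definition no_short_cycle (V : eqType) (e : rel V) (g : nat) :=
  forall c, ucycle e c -> 2 < size c -> g <= size c.

Section Incidence.
Variable G : finType.
Implicit Types (A B S : {set G}) (F : {set {set G}}).

Definition inc F A S := [&& #|A| == 2, S \in F & A \subset S].

Definition incidence F : rel {set G} := fun A B => inc F A B || inc F B A.

Definition triples F := forall S, S \in F -> #|S| = 3.

Lemma incidence_sym F : symmetric (incidence F).
Proof. by move=> A B; rewrite /incidence orbC. Qed.

Lemma incidence_triple F A S : triples F -> #|S| = 3 ->
  incidence F S A = inc F A S.
Proof.
move=> tF S3; rewrite /incidence orb_idl // /inc => /and3P[].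
by rewrite S3.
Qed.

(** A short cycle through one new triple only would join two distinct pairs of that triple by a
    short old path. One through both splits into two short old paths between their pairs; each is
    trivial, so both neighbours of a new triple on the cycle equal the intersection of the two
    triples. *)
Lemma no_short_cycle_add F S1 S2 g : triples F -> #|S1| = 3 -> #|S2| = 3 ->
  S1 != S2 ->
  (forall A B, #|A| = 2 -> #|B| = 2 -> (A \subset S1) || (A \subset S2) ->
     (B \subset S1) || (B \subset S2) -> A != B ->
     B \notin ball (incidence F) g A) ->
  no_short_cycle (incidence F) g ->
  no_short_cycle (incidence (S1 |: (S2 |: F))) g.
Proof.
move=> tF c1 c2 n12 far nF c /andP[cc uc] sc; set F' := _ |: _ in cc.
rewrite leqNgt; apply/negP => lt.
have tF' : triples F' by move=> S; rewrite !inE => /or3P[/eqP->|/eqP->|/tF].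
have old p (x : {set G}) : S1 \notin x :: p -> S2 \notin x :: p ->
    path (incidence F') x p -> path (incidence F) x p.
  elim: p x => //= y p IH x n1 n2 /andP[xy py].
  rewrite IH ?andbT //; try by [move: n1; rewrite !inE; case/norP |
     move: n2; rewrite !inE; case/norP].
  move: xy n1 n2; rewrite /incidence /inc /F' !inE !negb_or.
  rewrite !(eq_sym S1) !(eq_sym S2).
  by move=> E /and3P[/negbTE x1 /negbTE y1 _] /and3P[/negbTE x2 /negbTE y2 _]; move: E; rewrite x1 x2 y1 y2.
(* [S] is a new triple on the cycle and [T] is the other new triple. *)
have thr S T : (S, T) = (S1, S2) \/ (S, T) = (S2, S1) -> S \in c -> False.
  move=> ST Sc.
  have [S3 T3 nST] : [/\ #|S| = 3, #|T| = 3 & S != T].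
    by case: ST => [[-> ->]|[-> ->]]; rewrite ?(eq_sym S2).
  have {}old r x : S \notin x :: r -> T \notin x :: r ->
      path (incidence F') x r -> path (incidence F) x r.
    by case: ST => [[-> ->]|[-> ->]] *; apply: old.
  have {}far A B r : #|A| = 2 -> #|B| = 2 -> (A \subset S) || (A \subset T) ->
     (B \subset S) || (B \subset T) -> path (incidence F) A r -> last A r = B ->
     size r < g -> A = B.
    move=> A2 B2 AS BS pp lp sz; apply/eqP; have := path_ball pp (ltnW sz).
    rewrite lp; apply: contraTT => nAB; apply: far => //.
    - by case: ST AS => [[-> ->]|[-> ->]]; rewrite // orbC.
    - by case: ST BS => [[-> ->]|[-> ->]]; rewrite // orbC.
  have [a [p [pp la [Sa bS] [/= /andP[Sap uap] szc] sub]]] := cycle_at cc uc sc Sc.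
  move: Sa bS; rewrite (incidence_sym _ (last a p)) !incidence_triple //.
  move=> /and3P[/eqP a2 _ aS] /and3P[/eqP b2 _ bS].
  have szp : size p < g by move: lt; rewrite szc; apply: ltn_trans.
  have [Tp|Tp] := boolP (T \in a :: p); last first.
    have E : a = last a p by apply: (far a (last a p) p); rewrite ?aS ?bS //; apply: old.
    by rewrite -E eqxx in la.
  move: Tp; rewrite inE => /orP[/eqP E|Tp]; first by rewrite -E T3 in a2.
  case/splitPr: Tp pp la b2 bS uap szp Sap {szc sub} => p1 [|a'' p2].
    by rewrite last_cat /= T3.
  rewrite last_cat cat_path /= => /and4P[pp1 e1 e2 pp2] la b2 bS uap szp Sap.
  move: e1 e2; rewrite (incidence_sym _ (last a p1)) !incidence_triple //.
  move=> /and3P[/eqP a'2 _ a'T] /and3P[/eqP a''2 _ a''T].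
  rewrite size_cat /= in szp.
  rewrite inE mem_cat !inE !negb_or in Sap.
  case/and5P: Sap => Sa Sp1 _ Sa'' Sp2.
  move: uap; rewrite mem_cat cat_uniq !inE /= !inE !negb_or.
  case/andP => /and4P[ap1 aT _ _] /and4P[up1 /and3P[Tp1 _ _] /andP[Ta'' Tp2] _].
  have E1 : a = last a p1.
    apply: (far a (last a p1) p1 a2 a'2 _ _ _ erefl).
    - by rewrite aS.
    - by rewrite a'T orbT.
    - by apply: old; rewrite // inE negb_or ?Sa // eq_sym aT.
    - by apply: leq_ltn_trans szp; apply: leq_addr.
  have E2 : a'' = last a'' p2.
    apply: (far a'' (last a'' p2) p2 a''2 b2 _ _ _ erefl).
    - by rewrite a''T orbT.
    - by rewrite bS.
    - by apply: old; rewrite // inE negb_or ?Sa'' ?Ta''.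
    - by apply: leq_ltn_trans szp; rewrite (leq_trans (leqnSn _)) // (leq_trans (leqnSn _)) // leq_addl.
  rewrite -E1 in a'T; rewrite -E2 in la bS.
  have ST2 : #|S :&: T| <= 2.
    rewrite -ltnS -S3 proper_card // properEneq subsetIl andbT.
    apply: contra nST => /eqP/setIidPl sST.
    by rewrite eqEcard sST S3 T3.
  have E (A : {set G}) : #|A| = 2 -> A \subset S -> A \subset T -> A = S :&: T.
    by move=> A2 AS AT; apply/eqP; rewrite eqEcard subsetI AS AT A2.
  by rewrite (E a) // (E a'') ?eqxx // in la.
have [S1c|S1c] := boolP (S1 \in c); first by apply: (thr S1 S2) => //; left.
have [S2c|S2c] := boolP (S2 \in c); first by apply: (thr S2 S1) => //; right.
suff : ucycle (incidence F) c by move=> /nF /(_ sc); rewrite leqNgt lt.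
rewrite /ucycle uc andbT; case: c cc S1c S2c {uc sc lt thr} => //= x p pp n1 n2.
have dup S : S \notin x :: p -> S \notin x :: rcons p x.
  by rewrite !in_cons mem_rcons in_cons orbA orbb.
exact: old (dup _ n1) (dup _ n2) pp.
Qed.

(** A triple is adjacent only to some of its eight subsets; sets that are neither pairs nor triples
    are isolated. *)
Lemma incidence_degree F d A : triples F ->
  (forall A, #|A| = 2 -> #|[set S in F | A \subset S]| <= d) ->
  #|[set B | incidence F A B]| <= d + 8.
Proof.
move=> tF deg; have [A2|nA2] := eqVneq #|A| 2.
  apply: leq_trans (leq_trans (deg A A2) (leq_addr _ _)).
  apply/subset_leq_card/subsetP => B; rewrite !inE /incidence /inc A2 /=.
  by case/orP => [//|/and3P[_ /tF]]; rewrite A2.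
have [A3|nA3] := eqVneq #|A| 3.
  apply: (@leq_trans 8); last exact: leq_addl.
  rewrite (_ : 8 = #|powerset A|); last by rewrite card_powerset A3.
  apply/subset_leq_card/subsetP => B; rewrite inE incidence_triple //.
  by case/and3P => _ _ BA; rewrite powersetE.
rewrite (_ : [set B | _] = set0) ?cards0 //; apply/setP => B.
rewrite !inE /incidence /inc (negbTE nA2) /=.
by apply/negbTE; apply: contra nA3 => /and3P[_ /tF -> _].
Qed.

End Incidence.

(** * Configurations in a 6-partite ground set *)

Section Resample.
Variables (X R : finType) (tau : X * R -> X * R).
Hypothesis tau_inj : injective tau.

(* Double counting of the pairs [(x, r)] such that [tau (x, r)] lies above [Y]. *)
Lemma card_resample (Y : {set X}) c :
  (forall x, #|[set r | (tau (x, r)).1 \in Y]| <= c) -> #|R| * #|Y| <= #|X| * c.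
Proof.
move=> H; pose Z := [set xr | (tau xr).1 \in Y].
have -> : #|R| * #|Y| = #|Z|.
  rewrite mulnC -(cardsT R) -cardsX -(card_preimset _ tau_inj).
  by apply: eq_card => xr; rewrite !inE andbT.
have -> : #|Z| = \sum_x #|[set r | (tau (x, r)).1 \in Y]|.
  rewrite [RHS](eq_bigr (fun x => \sum_(r | (tau (x, r)).1 \in Y) 1)); last first.
    by move=> x _; rewrite -sum1_card; apply: eq_bigl => r; rewrite inE.
  rewrite pair_big_dep -sum1_card; apply: eq_bigl => -[x r]; by rewrite inE.
by rewrite -sum_nat_const; apply: leq_sum.
Qed.
End Resample.

(** In the applications [u] of [N] transversals are exceptional: a share of at most c Z / M, hence
    at most 1/(4K). *)
Lemma density_scale K N u M Z c : 0 < M ->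
  M * u <= c * (N * Z) -> 4 * c * K * Z <= M -> 4 * K * u <= N.
Proof.
move=> M0 h1 h2; rewrite -(leq_pmul2l M0) mulnCA.
apply: leq_trans (leq_mul (leqnn (4 * K)) h1) _.
rewrite [leqRHS]mulnC; apply: leq_trans (leq_mul (leqnn N) h2).
by apply: eq_leq; lia.
Qed.

(** Two exceptional sets of density 1/(4K) add up to 1/(2K); the factor [K] on both sides counts the
    patterns. *)
Lemma half_scale K N x y b n :
  4 * K * x <= N -> 4 * K * y <= N -> b <= x + y -> n <= K * b ->
  2 * K * n <= K * N.
Proof.
move=> hx hy hb hn; rewrite mulnAC mulnC leq_mul2l; apply/orP; right.
apply: leq_trans (leq_mul (leqnn 2) hn) _.
by have := leq_mul (leqnn (2 * K)) hb; lia.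
Qed.

Section Host.
Variable m : nat.
Notation alpha := {ffun 'I_6 -> 'I_m}.
Notation point := ('I_6 * 'I_m)%type.

Definition trace (al : alpha) (I : {set 'I_6}) : {set point} :=
  [set (i, al i) | i in I].

Lemma mem_trace al I (x : point) : (x \in trace al I) = (x.1 \in I) && (al x.1 == x.2).
Proof.
apply/imsetP/andP => [[i iI ->]|[xI /eqP E]]; first by rewrite iI eqxx.
by exists x.1; rewrite // E; case: x {xI E}.
Qed.

Lemma card_trace al I : #|trace al I| = #|I|.
Proof. by apply: card_imset => i j []. Qed.

Lemma trace_sub al I (A : {set point}) :
  A \subset trace al I -> exists2 J : {set 'I_6}, J \subset I & A = trace al J.
Proof.
move=> /subsetP sA; exists [set i | (i, al i) \in A].
  by apply/subsetP => i; rewrite inE => /sA; rewrite mem_trace => /andP[].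
apply/setP => x; rewrite mem_trace inE; apply/idP/andP => [xA|[xA /eqP E]].
  have := sA _ xA; rewrite mem_trace => /andP[_ /eqP E].
  by rewrite E eqxx; case: x xA {E}.
by rewrite E in xA; case: x xA {E}.
Qed.

Definition upd (al : alpha) (j : 'I_6) (a : 'I_m) : alpha :=
  [ffun i => if i == j then a else al i].

(** Resampling a coordinate while remembering its old value is reversible. *)
Lemma upd_inj j : injective (fun x : alpha * 'I_m => (upd x.1 j x.2, x.1 j)).
Proof.
move=> [al a] [be b] /= [E abj].
have ab : a = b by have /ffunP/(_ j) := E; rewrite !ffunE eqxx.
congr pair => //; apply/ffunP => i; have [->//|ij] := eqVneq i j.
by have /ffunP/(_ i) := E; rewrite !ffunE (negbTE ij).
Qed.

Lemma trace_upd al j a (I : {set 'I_6}) : j \notin I -> trace (upd al j a) I = trace al I.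
Proof.
move=> jI; apply: eq_in_imset => i iI; rewrite ffunE; case: eqP => // ij.
by rewrite -ij iI in jI.
Qed.

Lemma trace_upd_inj al j (I : {set 'I_6}) : j \in I -> injective (fun a => trace (upd al j a) I).
Proof.
move=> jI a b E; have : (j, a) \in trace (upd al j a) I.
  by rewrite mem_trace jI ffunE !eqxx.
by rewrite E mem_trace ffunE eqxx => /andP[_ /eqP].
Qed.

(** Resample a class in [J] but not in [I]: the trace on [I] stays fixed while that on [J] takes [m]
    distinct values, at most [b] of them in the ball. *)
Lemma card_trace_ball (bl : {set point} -> {set {set point}}) b (I J : {set 'I_6}) :
  #|I| = 2 -> #|J| = 2 -> I != J -> (forall A, #|bl A| <= b) ->
  m * #|[set al | trace al J \in bl (trace al I)]| <= #|{: alpha}| * b.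
Proof.
move=> I2 J2 nIJ Hb.
have [j jJ jI] : exists2 j, j \in J & j \notin I.
  apply/subsetPn; apply: contra nIJ => JI.
  by rewrite eq_sym eqEcard JI I2 J2.
rewrite -{1}(card_ord m); apply: (card_resample (@upd_inj j)) => al /=.
apply: leq_trans (Hb (trace al I)).
rewrite -(card_imset _ (@trace_upd_inj al j J jJ)).
apply/subset_leq_card/subsetP => A /imsetP[a]; rewrite !inE (trace_upd _ _ jI) => H ->.
exact: H.
Qed.

(** Resampling both classes of [I] gives [m ^ 2] distinct traces. *)
Lemma card_trace_in (Z : {set {set point}}) (I : {set 'I_6}) : #|I| = 2 ->
  m ^ 2 * #|[set al | trace al I \in Z]| <= #|{: alpha}| * #|Z|.
Proof.
move=> /eqP/cards2P[i [j [ij ->]]].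
pose tau (x : alpha * ('I_m * 'I_m)) :=
  (upd (upd x.1 i x.2.1) j x.2.2, (x.1 i, upd x.1 i x.2.1 j)).
have tau_inj : injective tau.
  move=> [al [a b]] [be [c d]] /= [/= E1 E2 E3].
  have [E4 E5] : (upd al i a, b) = (upd be i c, d).
    by apply: (@upd_inj j); rewrite /= E1 E3.
  have [-> ->] : (al, a) = (be, c) by apply: (@upd_inj i); rewrite /= E4 E2.
  by rewrite E5.
rewrite (_ : m ^ 2 = #|{: 'I_m * 'I_m}|); last by rewrite card_prod !card_ord mulnn.
apply: (card_resample tau_inj) => al /=.
have inj : injective (fun ab : 'I_m * 'I_m =>
    trace (upd (upd al i ab.1) j ab.2) [set i; j]).
  move=> [a b] [c d] /= E.
  have : (i, a) \in trace (upd (upd al i a) j b) [set i; j].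
    by rewrite mem_trace !inE eqxx !ffunE (negbTE ij) !eqxx.
  have : (j, b) \in trace (upd (upd al i a) j b) [set i; j].
    by rewrite mem_trace !inE eqxx orbT !ffunE !eqxx.
  rewrite E !mem_trace !ffunE !eqxx (negbTE ij).
  by move=> /andP[_ /eqP ->] /andP[_ /eqP ->].
rewrite -(card_imset _ inj); apply/subset_leq_card/subsetP => A /imsetP[[a b]].
by rewrite !inE => H ->.
Qed.

(* The pattern (i, j, l) and the transversal [al] stand for the two triples
   u x_i x_j and u x_i x_l, where u has class 0 and x_i has class i + 1. *)
Definition pattern := {t : 'I_5 * 'I_5 * 'I_5 | uniq [:: t.1.1; t.1.2; t.2]}.
Definition unit_t := (pattern * alpha)%type.
Implicit Types (w : unit_t) (s : seq unit_t).

Definition up (i : 'I_5) : 'I_6 := lift ord0 i.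

Lemma up_neq0 i : (up i == ord0) = false.
Proof. by []. Qed.

Lemma up_inj : injective up.
Proof. exact: lift_inj. Qed.

Definition unit1 w : {set point} :=
  trace w.2 [set ord0; up (val w.1).1.1; up (val w.1).1.2].
Definition unit2 w : {set point} :=
  trace w.2 [set ord0; up (val w.1).1.1; up (val w.1).2].

Definition fam s : {set {set point}} :=
  foldr (fun w F => unit1 w |: (unit2 w |: F)) set0 s.

Definition touch (A : {set point}) w :=
  (#|A| == 2) && ((A \subset unit1 w) || (A \subset unit2 w)).

Variables (g D t : nat).

(** The first condition caps the number of units touching a pair; the second is what
    [no_short_cycle_add] asks for. *)
Definition ok s w : bool :=
  [forall A, touch A w ==> (count (touch A) s < D)] &&
  [forall A, forall B, [&& touch A w, touch B w & A != B] ==>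
     (B \notin ball (incidence (fam s)) g A)].

Lemma cards_up (i j : 'I_5) : i != j -> #|[set ord0; up i; up j]| = 3.
Proof.
move=> nij; rewrite setUC cardsU1 cards2 !inE !negb_or !(inj_eq up_inj).
by rewrite (eq_sym j) nij !(eq_sym ord0) !up_neq0.
Qed.

Lemma card_unit1 w : #|unit1 w| = 3.
Proof.
rewrite card_trace cards_up //; have := valP w.1; rewrite /= !inE !negb_or.
by case/and3P => /andP[].
Qed.

Lemma card_unit2 w : #|unit2 w| = 3.
Proof.
rewrite card_trace cards_up //; have := valP w.1; rewrite /= !inE !negb_or.
by case/and3P => /andP[].
Qed.

Lemma unit_neq w : unit1 w != unit2 w.
Proof.
apply/eqP => E; have : (up (val w.1).1.2, w.2 (up (val w.1).1.2)) \in unit1 w.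
  by rewrite mem_trace /= !inE !eqxx !orbT.
rewrite E mem_trace /= !inE up_neq0 !(inj_eq up_inj).
have := valP w.1; rewrite /= !inE !negb_or => /and3P[/andP[n1 _] n2 _].
by rewrite eq_sym (negbTE n1) (negbTE n2).
Qed.

Lemma triples_fam s : triples (fam s).
Proof.
elim: s => [|w s IH] S /=; rewrite !inE //.
by case/or3P => [/eqP->|/eqP->|/IH]; rewrite ?card_unit1 ?card_unit2.
Qed.

Lemma ok_chain_touch s (A : {set point}) : ok_chain ok s -> count (touch A) s <= D.
Proof.
elim: s => //= w s IH /andP[/andP[/forallP/(_ A)/implyP H _] /IH le].
by case: (touch A w) H => // /(_ isT).
Qed.

Lemma ok_chain_girth s : ok_chain ok s -> no_short_cycle (incidence (fam s)) g.
Proof.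
elim: s => [_|w s IH /= /andP[/andP[_ /forallP H] /IH nc]].
  move=> [|x [|y c]] // /andP[/= /andP[+ _] _] _.
  by rewrite /incidence /inc !inE !andbF.
apply: no_short_cycle_add => //; rewrite ?card_unit1 ?card_unit2 ?unit_neq //.
  exact: triples_fam.
move=> A B A2 B2 A1 B1 nAB; have /forallP/(_ B)/implyP := H A; apply.
by rewrite /touch A2 B2 A1 B1 nAB.
Qed.

Lemma card_fam_above s (A : {set point}) : #|[set S in fam s | A \subset S]| <= 2 * count (touch A) s
  \/ #|A| != 2.
Proof.
have [A2|] := eqVneq #|A| 2; last by right.
left; elim: s => [|w s IH] /=.
  by rewrite (_ : [set _ in _ | _] = set0) ?cards0 //; apply/setP => S; rewrite !inE.
rewrite mulnDr; case: (boolP (touch A w)) => [_|].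
  have -> : 2 * true = #|[set unit1 w; unit2 w]| by rewrite cards2 unit_neq.
  apply: leq_trans (leq_add (leqnn _) IH); apply: leq_trans _ (leq_card_setU _ _).
  apply/subset_leq_card/subsetP => S; rewrite !inE -orbA.
  by case: (S == unit1 w); case: (S == unit2 w).
rewrite {1}/touch A2 andTb negb_or => /andP[/negbTE n1 /negbTE n2].
rewrite muln0 add0n; apply: leq_trans _ IH; apply/subset_leq_card/subsetP => S; rewrite !inE.
case/andP=> /or3P[/eqP->|/eqP->|->] //; by rewrite ?n1 ?n2.
Qed.

Lemma card_ball_chain s (A : {set point}) : ok_chain ok s ->
  #|ball (incidence (fam s)) g A| <= (2 * D + 9) ^ g.
Proof.
move=> oks; rewrite (_ : 2 * D + 9 = (2 * D + 8).+1); last by rewrite addnS.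
apply: card_ball => B; apply: incidence_degree => [|{}A A2]; first exact: triples_fam.
case: (card_fam_above s A) => [le|]; last by rewrite A2.
by rewrite (leq_trans le) // leq_mul2l ok_chain_touch.
Qed.

Definition saturated s : {set {set point}} := [set A | D <= count (touch A) s].

(** Double counting of touches: a unit has two triples, each with eight subsets. *)
Lemma card_saturated s : D * #|saturated s| <= 16 * size s.
Proof.
have touch_le w : \sum_A touch A w <= 16.
  apply: (@leq_trans (#|powerset (unit1 w)| + #|powerset (unit2 w)|)); last first.
    by rewrite !card_powerset card_unit1 card_unit2.
  rewrite -cardsUI -sum1_card; apply: leq_trans (leq_addr _ _).
  rewrite [X in _ <= X]big_mkcond; apply: leq_sum => A _.
  by rewrite !inE /touch; case: (_ == 2); case: (_ \subset _); case: (_ \subset _).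
have : \sum_A count (touch A) s <= 16 * size s.
  elim: s => [|w s IH] /=; first by rewrite big1.
  by rewrite big_split mulnS leq_add.
apply: leq_trans; rewrite (bigID (mem (saturated s))) /=.
apply: leq_trans _ (leq_addr _ _); rewrite mulnC -sum_nat_const.
by apply: leq_sum => A; rewrite inE.
Qed.

Hypothesis m_gt0 : 0 < m.
(* These cardinals are kept abstract lest conversion enumerate the types. *)
Variables c6 K : nat.
Hypothesis c6E : #|{: {set 'I_6}}| = c6.
Hypothesis KE : #|{: pattern}| = K.
Hypothesis D_large : 4 * c6 * K * (16 * t) <= D * m ^ 2.
Hypothesis D_gt0 : 0 < D.
Hypothesis m_large : 4 * (c6 * c6) * K * (2 * D + 9) ^ g <= m.

(** A unit is rejected only if its transversal has a saturated trace, or two distinct traces within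
    distance [g], on two-element sets of classes. Each event has density at most 1/(4K), by
    [card_saturated] and [card_ball_chain]. *)
Lemma few_not_ok s : ok_chain ok s -> size s <= t ->
  2 * K * #|[set w | ~~ ok s w]| <= #|{: unit_t}|.
Proof.
move=> oks szs.
set bl := ball (incidence (fam s)) g.
pose X (I : {set 'I_6}) := [set al : alpha | trace al I \in saturated s].
pose Y (IJ : {set 'I_6} * {set 'I_6}) :=
  [set al : alpha | trace al IJ.2 \in bl (trace al IJ.1)].
pose P2 (I : {set 'I_6}) := #|I| == 2.
pose Q2 (IJ : {set 'I_6} * {set 'I_6}) := [&& P2 IJ.1, P2 IJ.2 & IJ.1 != IJ.2].
pose bad := (\bigcup_(I | P2 I) X I) :|: (\bigcup_(IJ | Q2 IJ) Y IJ).
have touchE A w : touch A w -> exists2 I, P2 I & A = trace w.2 I.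
  case/andP=> A2 /orP[] /trace_sub[J _ E]; exists J => //;
  by rewrite /P2 -(card_trace w.2) -E.
have sub : [set w | ~~ ok s w] \subset setX [set: pattern] bad.
  apply/subsetP => w; rewrite !inE negb_and => /orP[|].
    rewrite negb_forall => /existsP[A]; rewrite negb_imply -leqNgt.
    case/andP => /touchE[I I2 ->] le; apply/orP; left; apply/bigcupP.
    by exists I; rewrite // !inE.
  rewrite negb_forall => /existsP[A]; rewrite negb_forall => /existsP[B].
  rewrite negb_imply negbK => /andP[/and3P[/touchE[I I2 ->] /touchE[J J2 ->] nIJ] inB].
  apply/orP; right; apply/bigcupP; exists (I, J); last by rewrite inE.
  by rewrite /Q2 I2 J2; apply: contraNneq nIJ => /= ->.
have cov (T : finType) (P : pred T) (Z : T -> {set alpha}) c k :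
    (forall i, P i -> k * #|Z i| <= c) -> k * #|\bigcup_(i | P i) Z i| <= #|T| * c.
  move=> H; apply: (@leq_trans (k * \sum_(i | P i) #|Z i|)).
    rewrite leq_mul2l; apply/orP; right.
    elim/big_rec2: _ => [|i y U _ le]; first by rewrite cards0.
    by rewrite (leq_trans (leq_card_setU _ _)) // leq_add2l.
  rewrite big_distrr /=; apply: leq_trans (leq_sum _ H) _.
  by rewrite sum_nat_const leq_mul2r max_card orbT.
have hX : m ^ 2 * #|\bigcup_(I | P2 I) X I| <= c6 * (#|{: alpha}| * #|saturated s|).
  by rewrite -c6E; apply: cov => I /eqP I2; apply: card_trace_in.
have hY : m * #|\bigcup_(IJ | Q2 IJ) Y IJ| <=
    (c6 * c6) * (#|{: alpha}| * (2 * D + 9) ^ g).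
  rewrite -c6E -card_prod.
  apply: cov => IJ /and3P[/eqP I2 /eqP J2 nIJ]; apply: card_trace_ball => // A.
  exact: card_ball_chain.
have hsat := card_saturated s.
have m2 : 0 < m ^ 2 by rewrite expn_gt0 m_gt0.
have sat2 : 4 * c6 * K * #|saturated s| <= m ^ 2.
  rewrite -(leq_pmul2l D_gt0) mulnCA; apply: leq_trans _ D_large.
  apply: leq_mul (leqnn _) _; apply: leq_trans hsat _; exact: leq_mul.
have x_le := density_scale m2 hX sat2.
have y_le := density_scale m_gt0 hY m_large.
have le := subset_leq_card sub; rewrite cardsX cardsT KE in le.
rewrite card_prod KE; apply: half_scale x_le y_le _ le.
exact: leq_card_setU.
Qed.
End Host.

(** * Numerical parameters *)

Lemma exp_beats_linear a g : exists j, a + g * j <= 2 ^ j.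
Proof.
exists (2 * (a + 2 * g)); set i := a + 2 * g.
have lt : i < 2 ^ i by apply: ltn_expl.
rewrite mulnC expnM -mulnn mulnn expnAC -mulnn.
by apply: leq_trans (leq_mul lt lt); rewrite /i; nia.
Qed.

Lemma leq_exp x y k : x <= y -> x ^ k <= y ^ k.
Proof. by case: k => [|k] le; rewrite ?expn0 // leq_exp2r. Qed.

(** For s = 2^j the left side is at most 2^(a + bg + gj), and the exponent is linear in j. *)
Lemma exp_beats_poly a b g : exists2 s, 0 < s & a * (b * s) ^ g <= 2 ^ s.
Proof.
have [j le] := exp_beats_linear (a + b * g) g.
exists (2 ^ j); first by rewrite expn_gt0.
apply: (@leq_trans (2 ^ (a + b * g + g * j))); last by rewrite leq_exp2l.
rewrite -addnA expnD leq_mul //; first exact/ltnW/ltn_expl.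
rewrite (mulnC g) -mulnDl expnM; apply: leq_exp.
by rewrite expnD leq_mul //; apply/ltnW/ltn_expl.
Qed.

(** This is (1 + 1/c)^(c+1) >= 2, from the first two terms of the binomial expansion. *)
Lemma bernoulli_pow c : 0 < c -> 2 * c ^ c.+1 <= c.+1 ^ c.+1.
Proof.
move=> c0; have H k : c ^ k.+1 + k.+1 * c ^ k <= c.+1 ^ k.+1.
  elim: k => [|k IH]; first by rewrite !expn1 expn0 mul1n addn1.
  rewrite [c.+1 ^ _]expnS; apply: leq_trans (leq_mul (leqnn _) IH).
  rewrite !expnS; move: (c ^ k) => z; nia.
apply: leq_trans (H c); rewrite mul2n -addnn leq_add2l expnS leq_mul //.
Qed.

(** The number of encodings over [p] ordered pairs of points: parent maps, two labels per pair, a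
    base colour per label value, and the colour of the copy. *)
Definition data_bound p := p ^ p * ((2 * p).+1 ^ (2 * p) * 2 ^ (2 * p).+1 * 2).

(** With m = 2^s there are fewer than 2^(32sp) encodings, and 2K greedy steps halve the survivors;
    this dictates [t]. Then [D] can be a constant times s, so of order log m, and its fixed power
    stays below m. *)
Lemma parameters c K g : 0 < K -> exists m D t,
  [/\ 0 < m, 0 < D, 4 * c * K * (16 * t) <= D * m ^ 2,
      4 * (c * c) * K * (2 * D + 9) ^ g <= m &
      data_bound (6 * m * (6 * m)) * (2 * K).-1 ^ t < (2 * K) ^ t].
Proof.
move=> K0; pose B := (64 * (64 * 36) * (c * K * K)).+1.
have [s s0 hs] := exp_beats_poly (4 * (c * c) * K) (2 * B + 9) g.
pose m := 2 ^ s; pose p := 6 * m * (6 * m).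
have m0 : 0 < m by rewrite expn_gt0.
exists m, (B * s), (2 * K * (32 * s * p)); split; rewrite ?muln_gt0 //.
- by rewrite /p /B -mulnn mulSn; nia.
- apply: leq_trans hs; rewrite leq_mul2l leq_exp ?orbT //.
  by rewrite mulnDl -mulnA leq_add2l leq_pmulr.
have p0 : 0 < p by rewrite /p !muln_gt0 m0.
have p_le : p <= 2 ^ (2 * s + 6).
  rewrite expnD (mulnC 2) expnM -/m (_ : p = m ^ 2 * 36); last by rewrite /p -mulnn; lia.
  by rewrite leq_mul2l orbT.
have p1_le : (2 * p).+1 <= 2 ^ (2 * s + 8).
  rewrite (_ : 2 * s + 8 = 2 + (2 * s + 6)); last by lia.
  by rewrite expnD; move: p_le p0; lia.
have dat : data_bound p <= 2 ^ ((2 * s + 6) * p + ((2 * s + 8) * (2 * p) + (2 * p).+1 + 1)).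
  rewrite /data_bound [leqRHS]expnD; apply: leq_mul.
    by rewrite expnM leq_exp.
  rewrite [leqRHS]expnD; apply: leq_mul => //.
  by rewrite [leqRHS]expnD; apply: leq_mul => //; rewrite (expnM 2) leq_exp.
have dat2 : data_bound p < 2 ^ (32 * s * p).
  apply: leq_ltn_trans dat _; rewrite ltn_exp2l // /p; nia.
have e : 2 * (2 * K).-1 ^ (2 * K) <= (2 * K) ^ (2 * K).
  by have := @bernoulli_pow (2 * K).-1; rewrite prednK ?muln_gt0 //; apply; lia.
rewrite !(expnM _ (2 * K)).
apply: leq_trans (leq_exp (32 * s * p) e); rewrite expnMn ltn_pmul2r //.
by rewrite !expn_gt0; apply/orP; left; apply/orP; left; lia.
Qed.

(** * Encoding the embeddings along a forest *)

(** [h] is the distance to the root of the component, and [par] moves to a neighbour nearer to the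
    root. *)
Lemma rooted_forest (P : finType) (e : rel P) : symmetric e ->
  exists (rt par : P -> P) (h : P -> nat),
  [/\ forall x y, e x y -> rt x = rt y,
      forall x, h x <= #|P|,
      forall x, par x = x -> x = rt x &
      forall x, par x != x -> e x (par x) /\ h (par x) < h x].
Proof.
move=> es; have cs : connect_sym e by apply: sym_connect_sym.
pose Q x k := [exists p : k.-tuple P, path e x p && (last x p == fingraph.root e x)].
have exQ x : exists k, Q x k.
  have /connectP[p pp lp] := connect_root e x.
  by exists (size p); apply/existsP; exists (in_tuple p); rewrite /= pp -lp eqxx.
pose h x := ex_minn (exQ x).
have hP x : Q x (h x) /\ forall k, Q x k -> h x <= k by rewrite /h; case: ex_minnP.
have step x : x != fingraph.root e x -> exists y, e x y && (h y < h x).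
  move=> nx; have [/existsP[pt]] := hP x.
  case: pt => [[|y p] sz] /andP[pp lp] _.
    by rewrite -(eqP lp) /= eqxx in nx.
  have /andP[xy py] : e x y && path e y p := pp.
  have {}lp : last y p == fingraph.root e x := lp.
  exists y; rewrite xy /=.
  have [_ hy] := hP y; rewrite -(eqP sz) /= ltnS; apply: hy.
  apply/existsP; exists (in_tuple p); rewrite /= py (eqP lp).
  by rewrite (root_connect cs) connect1.
pose par x := if x == fingraph.root e x then x else odflt x [pick y | e x y && (h y < h x)].
exists (fingraph.root e), par, h; split.
- by move=> x y xy; apply/eqP; rewrite (root_connect cs) connect1.
- move=> x; have /connectP[p pp lp] := connect_root e x.
  case/shortenP: pp lp => q pq uq _ lq; have [_ hx] := hP x.
  apply: leq_trans (hx (size q) _) _.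
    by apply/existsP; exists (in_tuple q); rewrite /= pq -lq eqxx.
  have := uniq_leq_size (s2 := enum P) uq; rewrite -cardE /= => H.
  by apply/ltnW/H => y _; rewrite mem_enum.
- move=> x; rewrite /par; case: (eqVneq x (fingraph.root e x)) => // nx.
  case: pickP => [y /andP[_ hy] /= yx|]; first by rewrite yx ltnn in hy.
  by have [y xy] := step x nx; move/(_ y); rewrite xy.
- move=> x; rewrite /par; case: (eqVneq x (fingraph.root e x)) => [_|nx]; first by rewrite eqxx.
  by case: pickP => [y /andP[]|] //=; rewrite eqxx.
Qed.

Section Decode.
Variables (P : finType) (n : nat) (par : P -> P) (lab : bool * P -> 'I_n).

(* The labels met on the way from [x] to its root, along at most [k] steps;
   every step of the forest crosses two edges of the cube. *)
Fixpoint decode (k : nat) (x : P) : seq 'I_n :=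
  if k is k'.+1 then
    if par x == x then [::]
    else [:: lab (false, x), lab (true, x) & decode k' (par x)]
  else [::].

Lemma mem_decode (rt : P -> P) k x t : (forall x, rt (par x) = rt x) ->
  t \in decode k x -> exists2 i, t = lab i & rt i.2 = rt x.
Proof.
move=> rtp; elim: k x => //= k IH x; case: eqP => // _.
rewrite !inE => /or3P[/eqP->|/eqP->|/IH[i ti ri]].
- by exists (false, x).
- by exists (true, x).
- by exists i; rewrite // ri rtp.
Qed.
End Decode.

Lemma decode_relabel (P : finType) n n' (par rt : P -> P) (lab : bool * P -> 'I_n)
    (r : P -> 'I_n -> 'I_n') k x : (forall x, rt (par x) = rt x) ->
  decode par (fun i => r (rt i.2) (lab i)) k x = map (r (rt x)) (decode par lab k x).
Proof.
move=> rtp; elim: k x => //= k IH x; case: eqP => //= _.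
by rewrite IH rtp.
Qed.

Lemma count_ltn_lt (s : seq nat) a b : a \in s -> a < b ->
  count (fun y => y < a) s < count (fun y => y < b) s.
Proof.
move=> + ab; elim: s => //= y s IH; rewrite inE => /orP[/eqP<-|/IH lt].
  rewrite ltnn ab add0n add1n ltnS; apply: sub_count => z /= za.
  exact: ltn_trans za ab.
rewrite -addnS leq_add //; case: (ltnP y a) => // ya.
by rewrite (ltn_trans ya ab).
Qed.

(** Replacing members of [s] by their ranks preserves order; this turns directions into boundedly
    many labels. *)
Lemma count_ltn_mono (s : seq nat) a b : a \in s -> b \in s ->
  (count (fun y => y < a) s < count (fun y => y < b) s) = (a < b).
Proof.
move=> sa sb; apply/idP/idP; last exact: count_ltn_lt.
apply: contraTT; rewrite -!leqNgt leq_eqVlt => /orP[/eqP-> //|ba].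
exact/ltnW/count_ltn_lt.
Qed.

Lemma odd_card_ord n (X : {set 'I_n}) (a : pred 'I_n) :
  odd #|[set y in X | a y]| = \big[addb/false]_(t | a t) (t \in X).
Proof.
rewrite -sum1_card (big_morph odd oddD (erefl _)).
rewrite big_mkcond [RHS]big_mkcond /=; apply: eq_bigr => t _; rewrite inE.
by case: (t \in X); case: (a t).
Qed.

(** * Compressing a copy into data of bounded size *)

Section Transport.
Variables (G : finType) (F : {set {set G}}) (n : nat) (k : bool).
Variables (f : {set G} -> {set 'I_n}) (dir : {set G} -> {set G} -> 'I_n).
Hypothesis f_dir : forall A S, inc F A S -> forall t,
  (t \in f S) = (t \in f A) (+) (t == dir A S).
Hypothesis f_col : forall A S, inc F A S ->
  odd #|[set y in f A | y < dir A S]| = k.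
Hypothesis f_inj2 : forall A B : {set G}, #|A| = 2 -> #|B| = 2 -> f A = f B -> A = B.
Hypothesis f_inj3 : {in F &, injective f}.

Notation P := (G * G)%type.
Notation N := #|{: G * G}|.

Definition pr (x : P) : {set G} := [set x.1; x.2].

Definition pair_rel : rel P := fun x y => [exists S, inc F (pr x) S && inc F (pr y) S].

(** Colours depend only on the order of the directions and on parities at the base points. So
    directions may be replaced by ranks, and a copy in a cube of any dimension leaves data whose
    size does not depend on [n]. *)
Lemma transport : exists (par : {ffun P -> P}) (lab : {ffun bool * P -> 'I_(2 * N).+1})
    (q : {ffun 'I_(2 * N).+1 -> bool}),
  forall S S' x1 x2 x3 y2 y3, S != S' ->
    [/\ inc F (pr x1) S, inc F (pr x2) S & inc F (pr x3) S] ->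
    [/\ inc F (pr x1) S', inc F (pr y2) S' & inc F (pr y3) S'] ->
    uniq [:: pr x1; pr x2; pr x3] -> uniq [:: pr x1; pr y2; pr y3] ->
    let D := decode par lab N in
    double_star q k (D x1) (D x2) (D x3) (D y2) (D y3).
Proof.
have es : symmetric pair_rel by move=> x y; apply: eq_existsb => S; rewrite andbC.
have [rt [par [h [rtE hN parP1 parP2]]]] := rooted_forest es.
have rt_par x : rt (par x) = rt x.
  have [->//|nx] := eqVneq (par x) x.
  by have [/rtE] := parP2 x nx.
pose mid x := odflt set0 [pick S | inc F (pr x) S && inc F (pr (par x)) S].
pose lab (i : bool * P) :=
  dir (pr (if i.1 then par i.2 else i.2)) (mid i.2).
have lab_step x t : par x != x ->
    (t \in f (pr x)) = (t \in f (pr (par x))) (+) (t == lab (false, x)) (+) (t == lab (true, x)).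
  move=> nx; have [/existsP[S0 HS0] _] := parP2 x nx.
  rewrite /lab /= /mid; case: pickP => [S /andP[i1 i2]|/(_ S0)]; last by rewrite HS0.
  have := f_dir i1 t; rewrite /= (f_dir i2).
  by case: (t \in f _); case: (t \in f _); case: (t == _); case: (t == _).
have decP x t j : h x <= j -> (t \in f (pr x)) =
    (t \in f (pr (rt x))) (+) odd (count_mem t (decode par lab j x)).
  elim: j x => [|j IH] x hx /=.
    have [e|nx] := eqVneq (par x) x; first by rewrite -(parP1 _ e) addbF.
    by have [_] := parP2 x nx; case: (h x) hx.
  have [e|nx] := eqVneq (par x) x; first by rewrite -(parP1 _ e) addbF.
  have [_ lt] := parP2 x nx; rewrite (lab_step x t nx) IH; last first.
    by rewrite -ltnS (leq_trans lt).
  rewrite rt_par /= !oddD !oddb !(eq_sym _ t).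
  by case: (t \in f _); case: (odd _); case: (t == _); case: (t == _).
(* Different components of the forest get disjoint labels, so that the single
   function [q] can record the base points of all of them. *)
pose code (c : P) (x : 'I_n) := enum_rank c * n + x.
have code_inj c x c' x' : code c x = code c' x' -> c = c' /\ x = x'.
  rewrite /code => E; have n0 : 0 < n := leq_ltn_trans (leq0n x) (ltn_ord x).
  have := congr1 (fun z => z %/ n) E; rewrite !divnMDl // !divn_small // !addn0.
  move=> /val_inj/enum_rank_inj ->; split=> //; apply: val_inj => /=.
  by have := congr1 (fun z => z %% n) E; rewrite !modnMDl !modn_small.
pose s := [seq code (rt i.2) (lab i) | i <- enum {: bool * P}].
(* There are [2 * N] forest labels, so ranks run from 0 to [2 * N]. *)
pose rank c (x : 'I_n) : 'I_(2 * N).+1 := inord (count (fun y => y < code c x) s).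
have rankE c x : rank c x = count (fun y => y < code c x) s :> nat.
  rewrite inordK // ltnS (leq_trans (count_size _ _)) // size_map -cardE.
  by rewrite (card_prod bool) card_bool.
pose dom c x := exists2 i, x = lab i & rt i.2 = c.
have dom_code c x : dom c x -> code c x \in s.
  by case=> i -> <-; apply/mapP; exists i; rewrite ?mem_enum.
have rank_lt c x y : dom c x -> dom c y -> (rank c x < rank c y) = (x < y).
  move=> dx dy; rewrite !rankE.
  by rewrite (count_ltn_mono (dom_code _ _ dx) (dom_code _ _ dy)) ltn_add2l.
have rank_inj c x c' x' : dom c x -> dom c' x' -> rank c x = rank c' x' -> c = c' /\ x = x'.
  move=> dx dx' E; apply: code_inj.
  have sx := dom_code _ _ dx; have sx' := dom_code _ _ dx'.
  have e := rankE c x; rewrite E rankE in e.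
  have := count_ltn_mono sx sx'; have := count_ltn_mono sx' sx.
  by rewrite e ltnn; case: ltngtP.
pose q (t : 'I_(2 * N).+1) : bool :=
  if [pick i | rank (rt i.2) (lab i) == t] is Some i
  then odd #|[set y in f (pr (rt i.2)) | y < lab i]| else false.
have qE c x : dom c x -> q (rank c x) = odd #|[set y in f (pr c) | y < x]|.
  case=> i -> <-; rewrite /q; case: pickP => [j /eqP E|/(_ i)]; last by rewrite eqxx.
  have [-> ->//] : rt j.2 = rt i.2 /\ lab j = lab i.
  by apply: rank_inj => //; [exists j | exists i].
exists (finfun par), [ffun i => rank (rt i.2) (lab i)], (finfun q).
pose L x := decode par lab N x.
have DE j x : decode (finfun par) [ffun i => rank (rt i.2) (lab i)] j x =
    map (rank (rt x)) (decode par lab j x).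
  rewrite -(decode_relabel lab rank j x rt_par).
  by elim: j x => //= j IH x; rewrite !ffunE IH.
have Ldom x t : t \in L x -> dom (rt x) t by apply: mem_decode.
have LE x t : (t \in f (pr x)) = (t \in f (pr (rt x))) (+) odd (count_mem t (L x)).
  exact: decP.
have neq_dir A B S : inc F A S -> inc F B S -> A != B -> dir A S != dir B S.
  move=> iA iB; apply: contraNneq => E; case/and3P: (iA) => /eqP A2 _ _.
  case/and3P: (iB) => /eqP B2 _ _; apply/eqP; apply: f_inj2 => //; apply/setP => t.
  by have := f_dir iA t; rewrite (f_dir iB) E; do 2! case: (t \in _); case: (_ == _).
(* The direction from [pr x] to [S] separates the images of [pr x] and [pr y], so it labels a forest
   step on the way from [x] or from [y] to the root. *)
have dirdom S x y : inc F (pr x) S -> inc F (pr y) S -> pr x != pr y ->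
    rt x = rt y /\ dom (rt x) (dir (pr x) S).
  move=> ix iy nxy; have rxy : rt x = rt y by apply: rtE; apply/existsP; exists S; rewrite ix.
  split=> //; set t := dir _ _; have := f_dir ix t; rewrite (f_dir iy) eqxx.
  rewrite (LE x) (LE y) -rxy (negbTE (neq_dir _ _ _ ix iy nxy)) addbF.
  have [tx|/count_memPn->] := boolP (t \in L x); first by move=> _; apply: Ldom.
  have [ty|/count_memPn->] := boolP (t \in L y); first by move=> _; rewrite rxy; apply: Ldom.
  by case: (t \in _).
(* [q] supplies the parity at the root, and [L x] the change along the forest path. *)
have col x S : inc F (pr x) S -> dom (rt x) (dir (pr x) S) ->
    colour (finfun q) (map (rank (rt x)) (L x)) (rank (rt x) (dir (pr x) S)) = k.
  move=> ix dx; rewrite -(f_col ix) /colour ffunE qE // count_map.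
  rewrite (_ : count _ _ = count (fun t : 'I_n => t < dir (pr x) S) (L x)); last first.
    by apply: eq_in_count => t /Ldom dt /=; rewrite rank_lt.
  rewrite odd_count !odd_card_ord -big_split; apply: eq_bigr => t _.
  by rewrite [RHS]LE.
have eqv S x y : inc F (pr x) S -> inc F (pr y) S -> rt x = rt y -> forall t,
   odd (count_mem t (rank (rt x) (dir (pr x) S) :: map (rank (rt x)) (L x))) ==
   odd (count_mem t (rank (rt x) (dir (pr y) S) :: map (rank (rt x)) (L y))).
  move=> ix iy rxy t; rewrite -!map_cons !count_map; apply/eqP.
  apply: eq_odd_count => {}t; have := f_dir ix t; rewrite (f_dir iy) (LE x) (LE y) -rxy.
  rewrite /= !oddD !oddb !(eq_sym t).
  case: (t \in _); case: (odd (count_mem t (L x))); case: (odd _);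
  by case: (_ == _); case: (_ == _).
have st S x1 x2 x3 : [/\ inc F (pr x1) S, inc F (pr x2) S & inc F (pr x3) S] ->
    uniq [:: pr x1; pr x2; pr x3] ->
    let r x := rank (rt x1) (dir (pr x) S) in let D x := map (rank (rt x)) (L x) in
    star (finfun q) k (D x1) (D x2) (D x3) (r x1, r x2, r x3).
  move=> [i1 i2 i3]; rewrite /= !inE negb_or andbT => /andP[/andP[n12 n13] n23].
  have [r12 d1] := dirdom S x1 x2 i1 i2 n12.
  have [r23 d2] := dirdom S x2 x3 i2 i3 n23.
  have [n31 r13] : pr x3 != pr x1 /\ rt x1 = rt x3 by rewrite r12 r23 eq_sym.
  have [_ d3] := dirdom S x3 x1 i3 i1 n31.
  have ne x y : inc F (pr x) S -> inc F (pr y) S -> pr x != pr y ->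
      rt x = rt x1 -> rt y = rt x1 ->
      dom (rt x) (dir (pr x) S) -> dom (rt y) (dir (pr y) S) ->
      rank (rt x1) (dir (pr x) S) != rank (rt x1) (dir (pr y) S).
    move=> ix iy nxy rx ry; rewrite rx ry => dx dy; apply/eqP => E.
    have [_ /eqP] := rank_inj _ _ _ _ dx dy E.
    by rewrite (negbTE (neq_dir _ _ _ ix iy nxy)).
  apply/and5P; split.
  - by rewrite /= !inE negb_or !ne.
  - by apply/forallP => t /=; rewrite -r12; apply: eqv.
  - by apply/forallP => t /=; rewrite -r13; apply: eqv.
  - by rewrite /= col.
  - by rewrite /= r12 col.
move=> S S' x1 x2 x3 y2 y3 nS iS iS' u u' /=; rewrite !DE.
apply/existsP; eexists; apply/existsP; eexists; apply/and3P; split.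
- exact: (st S).
- exact: (st S').
case: iS iS' u u' => i1 i2 _ [j1 j2 _]; rewrite /= !inE !negb_or.
move=> /and3P[/andP[n12 _] _ _] /and3P[/andP[n12' _] _ _].
have [_ d] := dirdom _ _ _ i1 i2 n12; have [_ d'] := dirdom _ _ _ j1 j2 n12'.
apply: contraNneq nS => E; have [_ e] := rank_inj _ _ _ _ d d' E.
case/and3P: (i1) (j1) => _ SF _ /and3P[_ SF' _].
apply/eqP/f_inj3 => //; apply/setP => t; by rewrite (f_dir i1) (f_dir j1) e.
Qed.

End Transport.

(** * The sparse triple system and its incidence graph *)

Section Combine.
Variable m : nat.
Notation G := ('I_6 * 'I_m)%type.
Notation N := #|{: G * G}|.
Notation alpha := {ffun 'I_6 -> 'I_m}.

Definition pt (al : alpha) (i : 'I_6) : G := (i, al i).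

(** [decode] reads ordered pairs; listing the smaller index first gives the symmetry that
    [double_star_contra] requires. *)
Definition pt_pair (al : alpha) (i j : 'I_5) : G * G :=
  if i <= j then (pt al (up i), pt al (up j)) else (pt al (up j), pt al (up i)).

Lemma pt_pair_sym al i j : pt_pair al i j = pt_pair al j i.
Proof.
by rewrite /pt_pair; case: (ltngtP i j) => // /val_inj ->.
Qed.

(* The parent map, the directions labelling the forest steps, the contribution
   of the base points to the colours, and the colour of the copy. *)
Definition data : finType :=
  ({ffun G * G -> G * G} *
   ({ffun bool * (G * G) -> 'I_(2 * N).+1} * {ffun 'I_(2 * N).+1 -> bool} * bool))%type.

Lemma card_data : #|data| = data_bound N.
Proof.
by rewrite /data !card_prod !card_ffun !card_prod !card_ord !card_bool.
Qed.

Definition good (d : data) (w : unit_t m) : bool :=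
  let D := decode d.1 d.2.1.1 N in
  let u := pt w.2 ord0 in
  let t := val w.1 in
  double_star d.2.1.2 d.2.2
    (D (u, pt w.2 (up t.1.1))) (D (u, pt w.2 (up t.1.2)))
    (D (pt_pair w.2 t.1.1 t.1.2))
    (D (u, pt w.2 (up t.2))) (D (pt_pair w.2 t.1.1 t.2)).

(** On every transversal some pattern fails, since otherwise [double_star_contra] would apply. *)
Lemma many_bad (d : data) :
  #|{: unit_t m}| <= #|{: pattern}| * #|[set w | ~~ good d w]|.
Proof.
rewrite card_prod leq_mul2l; apply/orP; right.
rewrite -(cardsT alpha); apply: leq_trans (leq_imset_card snd _).
apply/subset_leq_card/subsetP => al _; apply/imsetP.
suff /existsP[t bt] : [exists t : pattern, ~~ good d (t, al)].
  by exists (t, al); rewrite ?inE.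
apply: contraT => /existsPn H; exfalso.
pose D := decode d.1 d.2.1.1 N.
apply: (@double_star_contra _ d.2.1.2 d.2.2
  (fun i => D (pt al ord0, pt al (up i))) (fun i j => D (pt_pair al i j))).
  by move=> i j; rewrite pt_pair_sym.
move=> i j l U.
by have := H (exist _ (i, j, l) U); rewrite negbK.
Qed.

Lemma fam_unit s (w : unit_t m) : w \in s -> unit1 w \in fam s /\ unit2 w \in fam s.
Proof.
elim: s => //= x s IH; rewrite !inE => /orP[/eqP<-|/IH[h1 h2]].
  by rewrite !eqxx !orbT.
by rewrite h1 h2 !orbT.
Qed.

Lemma pr_trace (al : alpha) (i j : 'I_6) : pr (pt al i, pt al j) = trace al [set i; j].
Proof.
by rewrite /pr /trace imsetU1 imset_set1.
Qed.

Lemma pr_pt_pair (al : alpha) i j : pr (pt_pair al i j) = trace al [set up i; up j].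
Proof.
by rewrite /pt_pair; case: ifP => _; rewrite pr_trace // setUC.
Qed.

Lemma inc_trace (F : {set {set G}}) (al : alpha) (i j : 'I_6) (I : {set 'I_6}) : i != j -> i \in I -> j \in I ->
  trace al I \in F -> inc F (trace al [set i; j]) (trace al I).
Proof.
move=> nij iI jI IF; rewrite /inc card_trace cards2 nij IF /=.
by apply: imsetS; apply/subsetP => x; rewrite !inE => /orP[/eqP->|/eqP->].
Qed.

Lemma trace_neq (al : alpha) (I J : {set 'I_6}) : I != J -> trace al I != trace al J.
Proof.
apply: contraNneq => E; apply/eqP/setP => i.
by have := mem_trace al I (i, al i); rewrite E mem_trace eqxx !andbT.
Qed.

Lemma up_pairs (i j : 'I_5) : i != j ->
  uniq [:: [set ord0; up i]; [set ord0; up j]; [set up i; up j]].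
Proof.
move=> nij; rewrite /= !inE !negb_or andbT.
have neq (I J : {set 'I_6}) x : x \in I -> x \notin J -> I != J.
  by move=> xI; apply: contraNneq => <-.
apply/andP; split; [apply/andP; split|].
- by apply: (neq _ _ (up i)); rewrite !inE ?eqxx ?orbT // up_neq0 (inj_eq up_inj).
- by apply: (neq _ _ ord0); rewrite !inE ?eqxx // !(eq_sym ord0) !up_neq0.
- by apply: (neq _ _ ord0); rewrite !inE ?eqxx // !(eq_sym ord0) !up_neq0.
Qed.

Lemma realized_good (s : seq (unit_t m)) n (k : bool)
    (f : {set G} -> {set 'I_n}) (dir : {set G} -> {set G} -> 'I_n) :
  (forall A S, inc (fam s) A S -> forall t,
     (t \in f S) = (t \in f A) (+) (t == dir A S)) ->
  (forall A S, inc (fam s) A S -> odd #|[set y in f A | y < dir A S]| = k) ->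
  (forall A B : {set G}, #|A| = 2 -> #|B| = 2 -> f A = f B -> A = B) ->
  {in fam s &, injective f} ->
  exists d : data, all (good d) s.
Proof.
move=> fd fc f2 f3.
have [par [lab [q H]]] := transport fd fc f2 f3.
exists (par, (lab, q, k)); apply/allP => w /fam_unit[S1 S2].
have := unit_neq w; rewrite /good /=.
move: S1 S2; rewrite /unit1 /unit2; case: w => [[[[i j] l] /= U] al] /= S1 S2 nS.
move: U; rewrite /= !inE negb_or andbT => /andP[/andP[nij nil] njl].
have n0 x : ord0 != up x by rewrite eq_sym up_neq0.
apply: (H (trace al [set ord0; up i; up j]) (trace al [set ord0; up i; up l])) => //.
- split; rewrite ?pr_pt_pair ?pr_trace; apply: inc_trace;
  by rewrite // ?(inj_eq up_inj) // !inE eqxx ?orbT.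
- split; rewrite ?pr_pt_pair ?pr_trace; apply: inc_trace;
  by rewrite // ?(inj_eq up_inj) // !inE eqxx ?orbT.
- rewrite !pr_pt_pair !pr_trace; have := up_pairs nij.
  rewrite /= !inE !negb_or !andbT => /andP[/andP[h1 h2] h3].
  by rewrite !trace_neq.
- rewrite !pr_pt_pair !pr_trace; have := up_pairs nil.
  rewrite /= !inE !negb_or !andbT => /andP[/andP[h1 h2] h3].
  by rewrite !trace_neq.
Qed.

End Combine.

Lemma card_pattern_gt0 : 0 < #|{: pattern}|.
Proof.
pose o k (h : k < 5) := Ordinal h.
by apply/card_gt0P; exists (exist _ (@o 0 isT, @o 1 isT, @o 2 isT) isT).
Qed.

(** The greedy choice defeats all data, whereas a monochromatic copy would yield data good for every
    chosen unit. *)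
Lemma sparse_family g : exists m (F : {set {set 'I_6 * 'I_m}}),
  [/\ triples F, no_short_cycle (incidence F) g &
   forall n k (f : {set 'I_6 * 'I_m} -> {set 'I_n}) dir,
  (forall A S, inc F A S -> forall t,
     (t \in f S) = (t \in f A) (+) (t == dir A S)) ->
  (forall A S, inc F A S -> odd #|[set y in f A | y < dir A S]| = k) ->
  (forall A B : {set 'I_6 * 'I_m}, #|A| = 2 -> #|B| = 2 -> f A = f B -> A = B) ->
  {in F &, injective f} -> False].
Proof.
have K0 := card_pattern_gt0.
have [m [D [t [m0 D0 hD hm lt]]]] := parameters #|{: {set 'I_6}}| g K0.
exists m.
have W0 : 0 < #|{: unit_t m}|.
  by rewrite card_prod muln_gt0 K0 card_ffun !card_ord expn_gt0 m0.
have few s : ok_chain (@ok m g D) s -> size s <= t ->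
    2 * #|{: pattern}| * #|[set w | ~~ ok g D s w]| <= #|{: unit_t m}|.
  exact: (few_not_ok m0 erefl erefl hD D0 hm).
have ltd : #|data m| * (2 * #|{: pattern}|).-1 ^ t < (2 * #|{: pattern}|) ^ t.
  by rewrite card_data !card_prod !card_ord.
have [s [oks _ kill]] := greedy_kills K0 W0 (@many_bad m) few ltd.
exists (fam s); split; [exact: triples_fam|exact: ok_chain_girth oks|].
move=> n k f dir h1 h2 h3 h4; have [d /allP H] := realized_good h1 h2 h3 h4.
by have /hasP[w ws] := kill d; rewrite (H w ws).
Qed.

Section IncidenceGraph.
Variables (G : finType) (F : {set {set G}}).

(** All pairs and triples are vertices, isolated ones included, so an embedding is injective on all
    pairs. *)
Definition inc_vertex := {A : {set G} | (#|A| == 3) || (#|A|.+1 == 3)}.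

Definition inc_adj : rel inc_vertex := fun x y => incidence F (val x) (val y).

Lemma inc_adj_sym : symmetric inc_adj.
Proof. by move=> x y; rewrite /inc_adj incidence_sym. Qed.

Hypothesis tF : triples F.

Lemma inc_adj_irrefl : irreflexive inc_adj.
Proof.
move=> x; rewrite /inc_adj /incidence orbb /inc.
by apply/negbTE/negP => /and3P[/eqP x2 /tF]; rewrite x2.
Qed.

Definition inc_graph : sgraph := SGraph inc_adj_sym inc_adj_irrefl.

Lemma inc_graph_girth g : no_short_cycle (incidence F) g -> girth_at_least g inc_graph.
Proof.
move=> H; rewrite /girth_at_least /girth; case: boolp.pselect => // ex.
case: ex_minnP => k /andP[k2 /existsP[c /andP[cc uc]]] _.
have := H (map val c); rewrite size_map size_tuple; apply=> //.
by rewrite /ucycle (map_inj_uniq val_inj) uc andbT cycle_map.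
Qed.

Lemma inc_graph_layered : layered inc_graph.
Proof.
exists #|G|, 3.
pose r (A : {set G}) : hypercube #|G| := enum_rank @: A.
have r_inj : injective r by apply: imset_inj; apply: enum_rank_inj.
have rc A : #|r A| = #|A| by apply: card_imset; apply: enum_rank_inj.
have rW (x : inc_vertex) : r (val x) \in [set A : hypercube #|G| | (#|A| == 3) || (#|A|.+1 == 3)].
  by rewrite inE rc; apply: (valP x).
pose f : {ffun inc_graph -> edge_layer #|G| 3} := [ffun x => exist _ (r (val x)) (rW x)].
apply/existsP; exists f; apply/andP; split.
  by apply/injectiveP => x y; rewrite !ffunE => /(congr1 val) /= /r_inj /val_inj.
apply/forallP => x; apply/forallP => y; apply/implyP => xy; rewrite !ffunE.
have a : @cube_adj #|G| (r (val x)) (r (val y)).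
  have sub (A S : {set G}) : inc F A S -> (r A \subset r S) && (#|r S| == #|r A|.+1).
    by case/and3P => /eqP A2 /tF S3 AS; rewrite !rc A2 S3 imsetS.
  by rewrite /cube_adj; case/orP: xy => /sub ->; rewrite ?orbT.
rewrite /= /sub_adj /=; apply/andP; split=> //.
by apply/imsetP; exists (r (val x), r (val y)); rewrite ?inE.
Qed.

End IncidenceGraph.

(* On the edge [{A, A + x}]: the parity of the elements of [A] below [x]. *)
Definition prefix_colour n (E : {set hypercube n}) : bool :=
  odd #|[set y : 'I_n | [forall X in E, y \in (X : {set 'I_n})] &&
    [exists x : 'I_n, [exists X in E, x \in (X : {set 'I_n})] &&
        ~~ [forall X in E, x \in (X : {set 'I_n})] && (y < x)]]|.

Lemma cube_adjP n (X Y : {set 'I_n}) : cube_adj X Y ->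
  exists x, forall t, (t \in Y) = (t \in X) (+) (t == x).
Proof.
have sub (A B : {set 'I_n}) : (A \subset B) && (#|B| == #|A|.+1) ->
    exists2 x, x \notin A & B = x |: A.
  case/andP => AB /eqP c.
  have /cards1P[x Dx] : #|B :\: A| == 1 by rewrite cardsD (setIidPr AB) c subSnn.
  exists x; last by rewrite -Dx setUC setDE setUIr setUCr setIT (setUidPr AB).
  by have := set11 x; rewrite -Dx inE => /andP[].
case/orP => /sub[x xA ->]; exists x => t; rewrite !inE.
  by case: eqP => [->|] /=; rewrite ?(negbTE xA) ?addbF.
by case: eqP => [->|] /=; rewrite ?(negbTE xA) ?addbF.
Qed.

(** [X] may be either end of the edge: both ends have the same elements below [x]. *)
Lemma prefix_colourE n (X Y : {set 'I_n}) x :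
  (forall t, (t \in Y) = (t \in X) (+) (t == x)) ->
  prefix_colour [set (X : hypercube n); (Y : hypercube n)] = odd #|[set y in X | y < x]|.
Proof.
move=> H; rewrite /prefix_colour; congr (odd #|pred_of_set _|); apply/setP => y.
have fa t : [forall Z in [set (X : hypercube n); (Y : hypercube n)], t \in (Z : {set 'I_n})] =
    (t \in X) && (t != x).
  apply/forall_inP/idP => [h|/andP[tX tx] Z].
    have hX := h X (set21 X Y); have := h Y (set22 X Y).
    by rewrite H hX; case: (t == x).
  by rewrite !inE => /orP[] /eqP -> //; rewrite H tX (negbTE tx).
have ex t : [exists Z in [set (X : hypercube n); (Y : hypercube n)], t \in (Z : {set 'I_n})] =
    (t \in X) || (t == x).
  apply/exists_inP/idP => [[Z]|].
    rewrite !inE => /orP[] /eqP ->; first by move=> ->.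
    by rewrite H; case: (t \in X); case: (t == x).
  have [tX _|tX /= tx] := boolP (t \in X); first by exists X; rewrite ?set21.
  by exists Y; rewrite ?set22 // H (negbTE tX) tx.
rewrite !inE fa; have -> : [exists z : 'I_n, [exists X0 in [set (X : hypercube n); (Y : hypercube n)],
   z \in (X0 : {set 'I_n})] && ~~ [forall X0 in [set (X : hypercube n); (Y : hypercube n)],
   z \in (X0 : {set 'I_n})] && (y < z)] = (y < x).
  apply/existsP/idP => [[z]|yx]; last by exists x; rewrite ex fa eqxx andbF orbT.
  by rewrite ex fa; case: (eqVneq z x) => [->|_]; case: (_ \in X).
case: (ltnP y x) => yx; rewrite ?andbF // !andbT.
by case: eqP yx => [->|]; rewrite ?ltnn // andbT.
Qed.

Lemma large_girth_graph g : exists H : sgraph,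
  [/\ layered H, girth_at_least g H &
     forall n, 0 < n -> exists c : {set hypercube n} -> bool,
       forall f : {ffun H -> hypercube n}, ~ monochromatic_copy c f].
Proof.
have [m [F [tF nc H]]] := sparse_family g.
exists (inc_graph tF); split; [exact: inc_graph_layered|exact: inc_graph_girth|].
case=> // n _; exists (@prefix_colour n.+1) => f [/andP[/injectiveP fi /forallP fa] [k fk]].
(* The values [set0] and [ord0] are defaults; [ord0] exists because the dimension is positive. *)
pose f' (A : {set 'I_6 * 'I_m}) : {set 'I_n.+1} :=
  if insub A is Some x then f x else set0.
pose dir (A S : {set 'I_6 * 'I_m}) : 'I_n.+1 :=
  odflt ord0 [pick x | [forall t, (t \in f' S) == (t \in f' A) (+) (t == x)]].
have f'E (x : inc_graph tF) : f' (val x) = f x by rewrite /f' valK.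
have vert (A : {set 'I_6 * 'I_m}) : (#|A| == 3) || (#|A|.+1 == 3) -> exists x : inc_graph tF, val x = A.
  by move=> hA; exists (exist _ A hA).
have edge A S : inc F A S -> exists x y : inc_graph tF,
    [/\ val x = A, val y = S & adj x y].
  move=> iAS; case/and3P: (iAS) => /eqP A2 SF _.
  have [x xA] : exists x : inc_graph tF, val x = A by apply: vert; rewrite A2.
  have [y yS] : exists y : inc_graph tF, val y = S by apply: vert; rewrite (tF _ SF).
  by exists x, y; split=> //=; rewrite /inc_adj /incidence xA yS iAS.
have dirP A S : inc F A S -> forall t, (t \in f' S) = (t \in f' A) (+) (t == dir A S).
  move=> /edge[x [y [<- <- xy]]] t; rewrite /dir; case: pickP => [z /forallP/(_ t)/eqP //|].
  have /forallP/(_ y)/implyP/(_ xy)/cube_adjP[z Hz] := fa x.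
  move/(_ z)/negbT/negP; case; apply/forallP => {}t.
  by rewrite !f'E; apply/eqP/Hz.
have inj (x y : inc_graph tF) : f' (val x) = f' (val y) -> val x = val y.
  by rewrite !f'E => /fi ->.
apply: (H n.+1 k f' dir dirP).
- move=> A S iAS; have D := dirP A S iAS; have [x [y [xA yS xy]]] := edge _ _ iAS.
  rewrite -(fk _ _ xy) -(@prefix_colourE _ (f' A) (f' S)) //.
  by rewrite -xA -yS !f'E.
- move=> A B A2 B2; have hA : (#|A| == 3) || (#|A|.+1 == 3) by rewrite A2.
  have hB : (#|B| == 3) || (#|B|.+1 == 3) by rewrite B2.
  by have [x <-] := vert A hA; have [y <-] := vert B hB; apply: inj.
- move=> A B /tF A3 /tF B3; have hA : (#|A| == 3) || (#|A|.+1 == 3) by rewrite A3.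
  have hB : (#|B| == 3) || (#|B|.+1 == 3) by rewrite B3.
  by have [x <-] := vert A hA; have [y <-] := vert B hB; apply: inj.
Qed.

(** * Turán density *)

Section SubgraphEdges.
Variables (G : sgraph) (W : {set G}) (F : {set {set G}}).

Definition sub_edges : {set {set G}} := [set e in edges G | (e \subset W) && (e \in F)].

Lemma card_edges_subgraph : #|edges (subgraph W F)| = #|sub_edges|.
Proof.
have inj : injective (fun e : {set subgraph W F} => [set val x | x in e] : {set G}).
  by apply: imset_inj; apply: val_inj.
rewrite -(card_imset _ inj); apply: eq_card => e; apply/imsetP/idP.
  case=> e' /imsetP[[x y]]; rewrite inE /= /sub_adj => /andP[xy xyF] -> ->.
  rewrite imsetU1 imset_set1 inE xyF andbT; apply/andP; split.
    by apply/imsetP; exists (val x, val y); rewrite ?inE.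
  by apply/subsetP => z; rewrite !inE => /orP[] /eqP ->; apply: valP.
rewrite inE => /and3P[/imsetP[[x y] + E] eW eF]; rewrite inE /= => xy.
have xW : x \in W by apply: (subsetP eW); rewrite E set21.
have yW : y \in W by apply: (subsetP eW); rewrite E set22.
exists [set (exist _ x xW : subgraph W F); (exist _ y yW : subgraph W F)].
  apply/imsetP; exists (exist _ x xW, exist _ y yW) => //.
  by rewrite inE /= /sub_adj /= xy -E eF.
by rewrite imsetU1 imset_set1 E.
Qed.
End SubgraphEdges.

(** * Facets of the cube and averaging *)

Section Subcubes.
Variable n : nat.
Implicit Types (A B : {set 'I_n}) (y : 'I_n.+1) (b : bool).

Definition face y b A : {set 'I_n.+1} := (if b then [set y] else set0) :|: [set lift y t | t in A].

Lemma mem_face_lift y b A t : (lift y t \in face y b A) = (t \in A).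
Proof.
rewrite /face inE (mem_imset _ _ (@lift_inj _ y)).
by case: b; rewrite inE // eq_sym (negbTE (neq_lift _ _)).
Qed.

Lemma mem_face_self y b A : (y \in face y b A) = b.
Proof.
rewrite /face inE; case: b; rewrite inE ?eqxx //=.
by apply/negbTE/imsetP => -[t _ E]; have := neq_lift y t; rewrite -E eqxx.
Qed.

Lemma face_sub y b A B : (face y b A \subset face y b B) = (A \subset B).
Proof.
apply/subsetP/subsetP => AB x.
  by rewrite -(mem_face_lift y b) => /AB; rewrite mem_face_lift.
by case: (unliftP y x) => [t|] ->; rewrite ?mem_face_self // !mem_face_lift; apply: AB.
Qed.

Lemma face_inj y b : injective (face y b).
Proof. by move=> A B E; apply/eqP; rewrite eqEsubset -!(face_sub y b) E subxx. Qed.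

Lemma card_face y b A : #|face y b A| = b + #|A|.
Proof.
rewrite /face cardsU (card_imset _ (@lift_inj _ y)) (_ : _ :&: _ = set0).
  by rewrite cards0 subn0; case: b; rewrite ?cards1 ?cards0.
apply/setP => x; rewrite !inE; case: b; rewrite inE //=.
case: eqP => //= ->; by apply/negbTE/imsetP => -[t _ E]; have := neq_lift y t; rewrite -E eqxx.
Qed.

Lemma face_adj y b A B : cube_adj (face y b A) (face y b B) = cube_adj A B.
Proof. by rewrite /cube_adj !face_sub !card_face -!addnS !eqn_add2l. Qed.

Definition unface y (X : {set 'I_n.+1}) : {set 'I_n} := [set t | lift y t \in X].

Lemma unfaceK y (X : {set 'I_n.+1}) : face y (y \in X) (unface y X) = X.
Proof.
apply/setP => x; case: (unliftP y x) => [t|] ->; last by rewrite mem_face_self.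
by rewrite mem_face_lift inE.
Qed.

Definition face_edge (yb : 'I_n.+1 * bool) (e : {set hypercube n}) : {set hypercube n.+1} :=
  [set face yb.1 yb.2 A | A in e].

Lemma face_edge_inj yb : injective (face_edge yb).
Proof. by apply: imset_inj; apply: face_inj. Qed.

Lemma face_edge2 yb A B :
  face_edge yb [set (A : hypercube n); (B : hypercube n)] =
  [set (face yb.1 yb.2 A : hypercube n.+1); (face yb.1 yb.2 B : hypercube n.+1)].
Proof. by rewrite /face_edge imsetU1 imset_set1. Qed.

(** An edge in direction x lies in exactly one of the two facets for each coordinate other than x,
    and in none for x itself. *)
Lemma card_faces_of_edge (e : {set hypercube n.+1}) : e \in edges (hypercube n.+1) ->
  #|[set yb | e \in face_edge yb @: edges (hypercube n)]| = n.
Proof.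
case/imsetP => -[X Y]; rewrite inE /= => XY ->.
have [x Yx] := cube_adjP XY.
have Hx t : ((t \in (X : {set 'I_n.+1})) == (t \in (Y : {set 'I_n.+1}))) = (t != x).
  by rewrite Yx; case: (t \in _); case: (t == x).
rewrite (_ : [set _ | _] = (fun y => (y, y \in (X : {set 'I_n.+1}))) @: [set~ x]).
  by rewrite card_imset ?cardsC1 ?card_ord // => y z [].
apply/setP => -[y b]; rewrite inE; apply/imsetP/imsetP => [[e' /imsetP[[A B] + ->]]|].
  rewrite inE face_edge2 /= => AB E; exists y.
    rewrite !inE -Hx; have := set21 X Y; have := set22 X Y; rewrite !E !inE.
    by move=> /orP[] /eqP -> /orP[] /eqP ->; rewrite !mem_face_self.
  by have := set21 X Y; rewrite E !inE => /orP[] /eqP ->; rewrite mem_face_self.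
case=> y'; rewrite !inE -Hx => /eqP E [-> ->].
exists [set (unface y' X : hypercube n); (unface y' Y : hypercube n)].
  apply/imsetP; exists (unface y' X, unface y' Y); rewrite ?inE //=.
  by rewrite -(face_adj y' (y' \in (X : {set 'I_n.+1}))) unfaceK E unfaceK.
by rewrite face_edge2 /= unfaceK E unfaceK.
Qed.

Lemma sum_faces (S : {set {set hypercube n.+1}}) : S \subset edges (hypercube n.+1) ->
  \sum_(yb : 'I_n.+1 * bool) #|[set e in edges (hypercube n) | face_edge yb e \in S]| = #|S| * n.
Proof.
move=> /subsetP sS; rewrite -sum_nat_const.
rewrite (eq_bigr (fun e => \sum_(yb : 'I_n.+1 * bool) (e \in face_edge yb @: edges (hypercube n)))); last first.
  move=> e /sS/card_faces_of_edge {1}<-; rewrite -sum1_card big_mkcond.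
  by apply: eq_bigr => yb _; rewrite inE; case: (_ \in _).
rewrite exchange_big; apply: eq_bigr => yb _.
rewrite -(card_imset _ (@face_edge_inj yb)) -sum1_card big_mkcond [RHS]big_mkcond.
apply: eq_bigr => e _; rewrite (_ : (e \in _) = (e \in S) && (e \in face_edge yb @: edges (hypercube n))).
  by case: (e \in S); case: (_ \in _).
apply/imsetP/andP => [[e' + ->]|[eS /imsetP[e' e'E E]]].
  by rewrite inE => /andP[e'E e'S]; rewrite e'S imset_f.
by exists e'; rewrite // inE e'E -E.
Qed.

End Subcubes.

Section Averaging.
Variables (H : sgraph) (n : nat).

Lemma ex_cube_ge (W : {set hypercube n}) (F : {set {set hypercube n}}) :
  ~~ contains_copy (subgraph W F) H -> #|sub_edges W F| <= ex_cube n H.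
Proof.
move=> free; rewrite -card_edges_subgraph /ex_cube.
exact: (@leq_bigmax_cond _ _ (fun K : {set hypercube n} * {set {set hypercube n}} =>
   #|edges (subgraph K.1 K.2)|) (W, F)).
Qed.

(** A copy-free subgraph restricts to a copy-free subgraph of each of the [2 * n.+1] facets, and
    each edge lies in [n] of them. *)
Lemma ex_cube_averaging : ex_cube n.+1 H * n <= 2 * n.+1 * ex_cube n H.
Proof.
suff h (W : {set hypercube n.+1}) (F : {set {set hypercube n.+1}}) :
    ~~ contains_copy (subgraph W F) H -> #|sub_edges W F| * n <= 2 * n.+1 * ex_cube n H.
  rewrite {1}/ex_cube.
  elim/big_ind: _ => [//|x y hx hy|K hK]; first by rewrite maxnMl geq_max hx hy.
  by have := h _ _ hK; rewrite -card_edges_subgraph.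
move=> free; rewrite -sum_faces; last by apply/subsetP => e; rewrite inE => /andP[].
rewrite (_ : 2 * n.+1 = #|{: 'I_n.+1 * bool}|); last by rewrite card_prod card_ord card_bool mulnC.
rewrite -sum_nat_const; apply: leq_sum => -[y b] _.
pose W' : {set hypercube n} := [set A | face y b A \in W].
pose F' : {set {set hypercube n}} := [set e | face_edge (y, b) e \in F].
have sub : [set e in edges (hypercube n) | face_edge (y, b) e \in sub_edges W F] \subset sub_edges W' F'.
  apply/subsetP => e; rewrite !inE => /and4P[-> _ eW ->]; rewrite andbT /=.
  apply/subsetP => A Ae; rewrite inE; apply: (subsetP eW); exact: imset_f.
apply: leq_trans (subset_leq_card sub) _; apply: ex_cube_ge.
apply: contra free => /existsP[f /andP[/injectiveP fi /forallP fa]].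
have gW (x : H) : (face y b (val (f x)) : hypercube n.+1) \in W.
  by have := valP (f x); rewrite inE.
pose f' : {ffun H -> subgraph W F} := [ffun x => exist (fun z => z \in W) (face y b (val (f x)) : hypercube n.+1) (gW x)].
apply/existsP; exists f'; apply/andP; split.
  by apply/injectiveP => x z; rewrite !ffunE => /(congr1 val) /= /face_inj /val_inj /fi.
apply/forallP => x; apply/forallP => z; apply/implyP => xz; rewrite !ffunE.
have /forallP/(_ z)/implyP/(_ xz) := fa x.
rewrite /= /sub_adj /= => /andP[a]; rewrite inE face_edge2 /= => ->.
by rewrite face_adj a.
Qed.

End Averaging.

Lemma card_cube_edgesS n : #|edges (hypercube n.+1)| * n = 2 * n.+1 * #|edges (hypercube n)|.
Proof.
rewrite -sum_faces //.
rewrite (_ : 2 * n.+1 = #|{: 'I_n.+1 * bool}|); last by rewrite card_prod card_ord card_bool mulnC.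
rewrite -sum_nat_const; apply: eq_bigr => -[y b] _; apply: eq_card => e.
rewrite inE andb_idr // => /imsetP[[A B]]; rewrite inE /= => AB ->.
rewrite face_edge2; apply/imsetP; exists (face y b A, face y b B) => //.
by rewrite inE /= face_adj.
Qed.

Lemma card_cube_edges_gt0 n : 0 < #|edges (hypercube n.+1)|.
Proof.
apply/card_gt0P; exists [set (set0 : hypercube n.+1); ([set ord0] : hypercube n.+1)].
apply/imsetP; exists (set0, [set ord0]) => //.
by rewrite inE /= /cube_adj sub0set cards0 cards1.
Qed.

(** Both colour classes are copy-free, and together they contain all the edges. *)
Lemma ex_cube_colour (H : sgraph) n (c : {set hypercube n} -> bool) :
  (forall f : {ffun H -> hypercube n}, ~ monochromatic_copy c f) ->
  #|edges (hypercube n)| <= 2 * ex_cube n H.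
Proof.
move=> nc.
have half k : #|[set e in edges (hypercube n) | c e == k]| <= ex_cube n H.
  pose F := [set e | c e == k].
  rewrite (_ : [set _ in _ | _] = sub_edges setT F); last first.
    by apply/setP => e; rewrite !inE subsetT.
  apply: ex_cube_ge; apply/negP => /existsP[f /andP[/injectiveP fi /forallP fa]].
  apply: (nc [ffun x => val (f x)]); split.
    apply/andP; split; first by apply/injectiveP => x z; rewrite !ffunE => /val_inj /fi.
    apply/forallP => x; apply/forallP => z; apply/implyP => xz; rewrite !ffunE.
    by have /forallP/(_ z)/implyP/(_ xz)/andP[] := fa x.
  exists k => x z xz; rewrite !ffunE.
  by have /forallP/(_ z)/implyP/(_ xz)/andP[_] := fa x; rewrite inE => /eqP.
apply: (@leq_trans (#|[set e in edges (hypercube n) | c e == true]| +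
    #|[set e in edges (hypercube n) | c e == false]|)); last by have := half true; have := half false; lia.
apply: leq_trans _ (leq_card_setU _ _); apply/subset_leq_card/subsetP => e.
by rewrite !inE => ->; case: (c e).
Qed.

Lemma turan_density_ge_half (R : realType) (H : sgraph) :
  (forall n, 0 < n -> exists c : {set hypercube n} -> bool,
     forall f : {ffun H -> hypercube n}, ~ monochromatic_copy c f) ->
  (1 / 2 <= turan_density R H)%R.
Proof.
move=> Hc; rewrite /turan_density; set u := fun n => _.
have E0 n : (0 < #|edges (hypercube n.+1)|%:R :> R)%R by rewrite ltr0n card_cube_edges_gt0.
(* The cube of dimension 0 has no edges and its quotient is 0 by convention, so the sequence is
   studied from 1 on. *)
have ge_half n : (1 / 2 <= u n.+1)%R.
  have [c /ex_cube_colour le] := Hc n.+1 isT.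
  by rewrite /u ler_pdivlMr // mul1r ler_pdivrMl ?ltr0n // -natrM ler_nat.
(* The factors in [ex_cube_averaging] and [card_cube_edgesS] agree and cancel. *)
have dec n : (u n.+2 <= u n.+1)%R.
  rewrite /u ler_pdivrMr // mulrAC ler_pdivlMr // -!natrM ler_nat.
  rewrite -(@leq_pmul2l (2 * n.+2)) // mulnCA -card_cube_edgesS.
  rewrite [leqLHS]mulnCA [leqLHS]mulnC [leqRHS]mulnA.
  by rewrite leq_mul2r ex_cube_averaging orbT.
have cv : cvgn (fun n => u n.+1).
  apply: nonincreasing_is_cvgn.
    by apply/nonincreasing_seqP.
  by exists (1 / 2)%R => _ [n _ <-].
have cu : cvgn u by have /cvg_ex[l ul] := cv; apply/cvg_ex; exists l; rewrite -cvg_shiftS.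
apply: limr_ge => //; exists 1 => // -[|n] // _; exact: ge_half.
Qed.

Unset Implicit Arguments.

Theorem theorem1p1 (g : nat) (hg : 3 <= g) :
  exists H : sgraph,
    [/\ layered H,
        girth_at_least g H,
        forall n : nat, 0 < n ->
          exists c : {set hypercube n} -> bool,
            forall f : {ffun H -> hypercube n}, ~ monochromatic_copy c f
      & forall R : realType, (1 / 2 <= turan_density R H)%R].
Proof.
have [H [lay gir col]] := large_girth_graph g.
by exists H; split=> // R; apply: turan_density_ge_half.
Qed.
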